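(* Suppose that $\Lambda=K\Gamma/I$ has finite uniserial type, and let $p$ be a mast of a uniserial left $\Lambda$-module having composition length $\le 5$. Then the graphs of slack halyards on $p$ which do not emerge from the top vertex are among the subgraphs of the following three layered graphs, where $1,2,3$ denote distinct vertices of $\Gamma$: (A) nodes $1,1,1,2,3$ in layers $0,1,2,3,4$; an edge between each pair of consecutive layers, where the edge between layers $2$ and $3$ is labeled by an arrow $\alpha:1\to2$; and one further edge, labeled $\alpha$, joining layer $1$ to layer $3$. (B) nodes $1,1,1,1,2$ in layers $0,1,2,3,4$; an edge between each pair of consecutive layers, where the edge between layers $3$ and $4$ is labeled by an arrow $\alpha:1\to 2$; and two further edges, both labeled $\alpha$, joining layer $1$ to layer $4$ and layer $2$ to layer $4$, respectively. (C) nodes $1,2,1,2,3$ in layers $0,1,2,3,4$; edges between consecutive layers labeled, from top to bottom, $\alpha,\beta,\alpha,\gamma$, where $\alpha:1\to2$, $\beta:2\to1$, $\gamma:2\to3$ are arrows; and one further edge, labeled $\gamma$, joining layer $1$ to layer $4$.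
   Context: **Setting.** $K$ is an infinite field, $\Gamma$ a finite quiver, $I$ an admissible ideal of the path algebra $K\Gamma$, $\Lambda=K\Gamma/I$ (a finite dimensional split basic $K$-algebra), and $J$ its Jacobson radical. Vertices of $\Gamma$ are identified with the corresponding primitive idempotents of $\Lambda$. Paths are composed so that $qp$ means ''$q$ after $p$''; vertices are the paths of length $0$. A right subpath of a path $p$ is a path $u$ with $p=u'u$ in $K\Gamma$ for some path $u'$ (lengths $0$ allowed). Modules are finitely generated left modules. **Uniserial modules, masts.** A module is uniserial if its submodules form a chain. If $U$ is uniserial of composition length $l+1$, a mast of $U$ is a path $p$ in $K\Gamma$ of length $l$ with $pU\neq 0$; a path is called a mast if it is a mast of some uniserial left $\Lambda$-module. A top element of $U$ is an element $x\in U\setminus JU$ with $x=ex$ for a vertex $e$. $\Lambda$ has finite uniserial type if there are only finitely many isomorphism classes of uniserial left $\Lambda$-modules. **Detours and $V_p$.** Let $p$ be a path. A detour on $p$ is a pair $(\alpha,u)$ with $u$ a right subpath of $p$ (possibly of length $0$) and $\alpha$ an arrow such that $\alpha u$ is a path which is not a right subpath of $p$, but there is a right subpath of $p$ strictly longer than $u$ ending in the same vertex as $\alpha$. All right subpaths of $p$ that are longer than $u$ and end in the same vertex as $\alpha$ are denoted $v_i(\alpha,u)$, $i\in I(\alpha,u)$. Let $D$ be the set of triples $(\alpha,u,i)$ with $(\alpha,u)$ a detour on $p$ and $i\in I(\alpha,u)$, with corresponding independent variables $X_i(\alpha,u)$. $V_p\subseteq K^D$ is the set of all points $k=(k_i(\alpha,u))$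 for which there are a uniserial left $\Lambda$-module $U$ with mast $p$ and a top element $x$ of $U$ with $\alpha ux=\sum_{i\in I(\alpha,u)}k_i(\alpha,u)v_i(\alpha,u)x$ for all detours $(\alpha,u)$ on $p$; this set is known to be Zariski closed. $A_p$ is the coordinate ring of $V_p$, i.e. the polynomial ring in the $X_i(\alpha,u)$ modulo the ideal of polynomials vanishing on $V_p$. **Halyards and their graphs.** Let $p$ be a mast. A detour $(\alpha,u)$ on $p$ is a halyard on $p$ if some $X_j(\alpha,u)$ has nonzero image in $A_p$ (equivalently, $\alpha ux\neq0$ for some uniserial module with mast $p$ and some top element $x$ of it). It is a slack halyard if some $X_j(\alpha,u)$ has image in $A_p$ transcendental over $K$ (equivalently, the coordinate $k_j(\alpha,u)$ takes infinitely many values on $V_p$). A halyard $(\alpha,u)$ emerges from the top vertex of $p$ if $u$ has length $0$. Given a uniserial module $U$ with mast $p=\alpha_l\cdots\alpha_1$ and top element $x$, place the vertices $e(0),\dots,e(l)$ consecutively touched by $p$ in layers $0,\dots,l$, joined by the edges $\alpha_1,\dots,\alpha_l$ of $p$ between consecutive layers; a halyard $(\alpha,u)$ on $p$ with $\alpha ux\ne0$ is drawn as an edge labeled $\alpha$ joining layer $\operatorname{length}(u)$ to layer $j$, where $\Lambda\alpha ux=J^jU$. A graph of (a set of) halyards on $p$ is the layered graph consisting of the edge path $p$ together with the edges so obtained for those halyards, for some choice of $U$ and $x$. *)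

(* Defs.v *)
From HB Require Import structures.
From mathcomp Require Import all_boot all_order all_algebra finmap.
From mathcomp.multinomials Require Import monalg.

Set Implicit Arguments.
Unset Strict Implicit.
Unset Printing Implicit Defensive.

Import GRing.Theory.
Local Open Scope ring_scope.

Record quiver := Quiver {
  vertex : finType;
  arrow : finType;
  src : arrow -> vertex;
  tgt : arrow -> vertex }.

Fixpoint is_walk (G : quiver) (v : vertex G) (s : seq (arrow G)) : bool :=
  if s is a :: s' then (src a == v) && is_walk (tgt a) s' else true.

(* The path alpha_l ... alpha_1 is stored with its arrows in order of          *)
(* traversal, [:: alpha_1; ...; alpha_l]; the starting vertex is kept so that  *)
(* the vertices are the paths of length 0.                                     *)
Record qpath (G : quiver) := QPath {
  pval : vertex G * seq (arrow G);
  pvalP : is_walk pval.1 pval.2 }.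

HB.instance Definition _ (G : quiver) := [isSub for @pval G].
HB.instance Definition _ (G : quiver) := [Choice of qpath G by <:].

Section Paths.
Context {G : quiver}.
Implicit Types (p q u v : qpath G) (a : arrow G) (s t : seq (arrow G)).

Definition pstart p : vertex G := (val p).1.
Definition parrows p : seq (arrow G) := (val p).2.
Definition plen p : nat := size (parrows p).

Definition walk_end (e : vertex G) s : vertex G := last e (map (@tgt G) s).
Definition pend p : vertex G := walk_end (pstart p) (parrows p).
Definition pnodes p : seq (vertex G) := pstart p :: map (@tgt G) (parrows p).

Lemma is_walk_cat (e : vertex G) s t :
  is_walk e (s ++ t) = is_walk e s && is_walk (walk_end e s) t.
Proof. by elim: s e => [|a s IH] e //=; rewrite IH andbA. Qed.

Lemma is_walk_take k p : is_walk (pstart p) (take k (parrows p)).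
Proof.
by have := pvalP p; rewrite -/(pstart p) -/(parrows p)
  -{1}(cat_take_drop k (parrows p)) is_walk_cat => /andP[].
Qed.

Definition pvertex (e : vertex G) : qpath G := @QPath G (e, [::]) isT.

Lemma parrow_subproof a : is_walk (src a) [:: a].
Proof. by rewrite /= eqxx. Qed.
Definition parrow a : qpath G := @QPath G (src a, [:: a]) (parrow_subproof a).

(* [pcomp q p] is the path "q after p". *)
Definition pcomp q p : option (qpath G) :=
  if pstart q == pend p then insub (pstart p, parrows p ++ parrows q) else None.

Lemma pcompE q p r : (pcomp q p == Some r) =
  [&& pstart q == pend p, pstart r == pstart p
    & parrows r == parrows p ++ parrows q].
Proof.
rewrite /pcomp; have [eqp|//] := eqVneq (pstart q) (pend p).
case: insubP => [w _ ew | /negP[]] /=.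
  apply/eqP/andP => [[<-]|[/eqP e1 /eqP e2]].
    by rewrite /pstart /parrows ew /=.
  by congr Some; apply: val_inj; rewrite ew -e1 -e2 [RHS]surjective_pairing.
by rewrite is_walk_cat (pvalP p) -/(pend p) -eqp (pvalP q).
Qed.

Lemma pcomp_arrowsP q p : pstart q = pend p ->
  {r | pcomp q p = Some r & pstart r = pstart p /\
       parrows r = parrows p ++ parrows q}.
Proof.
move=> e; case E: (pcomp q p) => [r|].
  exists r => //; move/eqP: E; rewrite pcompE.
  by case/and3P=> _ /eqP-> /eqP->.
move: E; rewrite /pcomp e eqxx; case: insubP => // /negP[] /=.
by rewrite is_walk_cat (pvalP p) -/(pend p) -e (pvalP q).
Qed.

Lemma pend_comp q p r : pcomp q p = Some r -> pend r = pend q.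
Proof.
move/eqP; rewrite pcompE => /and3P[/eqP e1 /eqP e2 /eqP e3].
rewrite /pend e2 e3 /walk_end map_cat last_cat e1 /pend /walk_end.
by case: (map _ (parrows q)).
Qed.

Lemma pstart_comp q p r : pcomp q p = Some r -> pstart r = pstart p.
Proof. by move/eqP; rewrite pcompE => /and3P[_ /eqP ->]. Qed.

Lemma pcomp_None q p : pstart q != pend p -> pcomp q p = None.
Proof. by rewrite /pcomp => /negPf ->. Qed.

Lemma pcompA r q p :
  obind (fun w => pcomp r w) (pcomp q p) = obind (fun w => pcomp w p) (pcomp r q).
Proof.
have [e1|ne1] := eqVneq (pstart q) (pend p); last first.
  rewrite (pcomp_None ne1) /=; case E: (pcomp r q) => [w|] //=.
  by rewrite pcomp_None // (pstart_comp E).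
have [w Ew [w1 w2]] := pcomp_arrowsP e1; rewrite Ew /=.
have [e2|ne2] := eqVneq (pstart r) (pend q); last first.
  by rewrite (pcomp_None ne2) /= pcomp_None // (pend_comp Ew).
have [z Ez [z1 z2]] := pcomp_arrowsP e2; rewrite Ez /=.
have e3 : pstart r = pend w by rewrite (pend_comp Ew).
have e4 : pstart z = pend p by rewrite z1.
have [m -> [m1 m2]] := pcomp_arrowsP e3.
apply/esym/eqP; rewrite pcompE e4 eqxx m1 w1 eqxx /= m2 w2 z2 catA.
exact: eqxx.
Qed.

Lemma pcomp_vl (e : vertex G) p :
  pcomp (pvertex e) p = if e == pend p then Some p else None.
Proof.
case: eqP => e1; last by rewrite pcomp_None //; apply/eqP.
by apply/eqP; rewrite pcompE cats0 !eqxx -e1 eqxx.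
Qed.

Lemma pcomp_vr p (e : vertex G) :
  pcomp p (pvertex e) = if pstart p == e then Some p else None.
Proof.
case: eqP => e1; last by rewrite pcomp_None //; apply/eqP.
by apply/eqP; rewrite pcompE !eqxx e1 eqxx.
Qed.

Definition right_subpath u p : Prop := exists u', pcomp u' u = Some p.

Definition ptake k p : qpath G := @QPath G (_, _) (is_walk_take k p).
Definition right_subpaths p : seq (qpath G) :=
  [seq ptake k p | k <- iota 0 (plen p).+1].

Lemma right_subpathsP u p : reflect (right_subpath u p) (u \in right_subpaths p).
Proof.
apply: (iffP mapP) => [[k _ ->]|[u' /eqP]].
  have wd : is_walk (pend (ptake k p)) (drop k (parrows p)).
    have := pvalP p; rewrite -/(pstart p) -/(parrows p).
    by rewrite -{1}(cat_take_drop k (parrows p)) is_walk_cat => /andP[].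
  exists (@QPath G (_, _) wd); apply/eqP.
  by rewrite pcompE eqxx /= cat_take_drop !eqxx.
rewrite pcompE => /and3P[_ /eqP e2 /eqP e3]; exists (plen u).
  by rewrite mem_iota add0n ltnS /plen e3 size_cat leq_addr.
apply: val_inj => /=; rewrite e2 e3 take_size_cat //.
by rewrite -surjective_pairing.
Qed.

(* The paths v_i(a, u). *)
Definition longer_subpaths p a u : seq (qpath G) :=
  [seq v <- right_subpaths p | (plen u < plen v)%N && (pend v == tgt a)].

Definition detour p a u : bool :=
  [&& u \in right_subpaths p,
      (if pcomp (parrow a) u is Some w then w \notin right_subpaths p else false)
    & longer_subpaths p a u != [::]].

Definition detours p : seq (arrow G * qpath G) :=
  [seq au <- [seq (a, u) | a <- enum (arrow G), u <- right_subpaths p]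
         | detour p au.1 au.2].

(* The index set D: the triple (a, u, i) is represented by (a, u, v_i(a, u)).  *)
Definition detour_index p : finType :=
  seq_sub [seq (au, v) | au <- detours p, v <- longer_subpaths p au.1 au.2].

Definition didx_detour p (d : detour_index p) : arrow G * qpath G := (val d).1.
Definition didx_path p (d : detour_index p) : qpath G := (val d).2.

End Paths.

(* Linear extension to {malg K[T]} of a partial composition on a set T, with   *)
(* product 0 where the composite is undefined; the path algebra is the case of *)
(* paths.                                                                      *)
Section PartialMonoidAlgebra.
Context {K : fieldType} {T : choiceType} {E : finType}.
Variables (comp : T -> T -> option T) (idt : E -> T) (dom cod : T -> E).
Hypothesis compA : forall r q p,
  obind (fun w => comp r w) (comp q p) = obind (fun w => comp w p) (comp r q).
Hypothesis comp1l : forall e p,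
  comp (idt e) p = if e == cod p then Some p else None.
Hypothesis comp1r : forall p e,
  comp p (idt e) = if dom p == e then Some p else None.
Local Notation KT := {malg K[T]}.
Implicit Types (x y z : KT) (p q r : T).

Definition lin_ext (f : T -> KT) x : KT := \sum_(p <- msupp x) mcoeff p x *: f p.

Definition basis_mul q p : KT := if comp q p is Some r then << r >> else 0.

Fact malg_mul_key : unit. Proof. exact: tt. Qed.
Definition malg_mul : KT -> KT -> KT := locked_with malg_mul_key
  (fun x y => lin_ext (fun q => lin_ext (basis_mul q) y) x).

Lemma malg_mulE x y :
  malg_mul x y = lin_ext (fun q => lin_ext (basis_mul q) y) x.
Proof. by rewrite /malg_mul unlock. Qed.

Definition malg_one : KT := \sum_(e : E) << idt e >>.

Lemma malgUZ (c : K) p : << c *g p >> = c *: << p >> :> KT.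
Proof.
by apply/malgP => q; rewrite mcoeffZ !mcoeffU; case: eqP; rewrite ?mulr1 ?mulr0.
Qed.

Lemma lin_extw f x (A : {fset T}) :
  (msupp x `<=` A)%fset -> lin_ext f x = \sum_(p <- A) mcoeff p x *: f p.
Proof.
move=> le; rewrite /lin_ext (big_fset_incl _ le) //= => p _ pN.
by rewrite mcoeff_outdom ?scale0r.
Qed.

Lemma lin_extD f : {morph lin_ext f : x y / x + y}.
Proof.
move=> x y; set A := (msupp x `|` msupp y)%fset.
rewrite (@lin_extw _ (x + y) A) ?msuppD_le //.
rewrite (@lin_extw _ x A) ?fsubsetUl // (@lin_extw _ y A) ?fsubsetUr //.
by rewrite -big_split /=; apply: eq_bigr => p _; rewrite mcoeffD scalerDl.
Qed.

Lemma lin_ext0 f : lin_ext f 0 = 0.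
Proof. by rewrite /lin_ext msupp0 big_seq_fset0. Qed.

Lemma lin_extU f c p : lin_ext f << c *g p >> = c *: f p.
Proof.
by rewrite (@lin_extw _ _ [fset p]%fset) ?msuppU_le // big_seq_fset1 mcoeffUU.
Qed.

Lemma lin_ext_sum f (J : Type) (s : seq J) (F : J -> KT) :
  lin_ext f (\sum_(j <- s) F j) = \sum_(j <- s) lin_ext f (F j).
Proof. exact: (big_morph _ (lin_extD f) (lin_ext0 f)). Qed.

Lemma malg_mulDl : left_distributive malg_mul +%R.
Proof. by move=> x y z; rewrite !malg_mulE; apply: lin_extD. Qed.

Lemma malg_mulDr : right_distributive malg_mul +%R.
Proof.
move=> x y z; rewrite !malg_mulE [in RHS]/lin_ext -big_split /=.
by apply: eq_bigr => p _; rewrite lin_extD scalerDr.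
Qed.

Lemma malg_mul0l : left_zero 0 malg_mul.
Proof. by move=> x; rewrite malg_mulE; apply: lin_ext0. Qed.

Lemma malg_mul0r : right_zero 0 malg_mul.
Proof.
move=> x; rewrite malg_mulE [LHS]big1 // => p _.
by rewrite lin_ext0 scaler0.
Qed.

Lemma malg_mulUU (c d : K) q p :
  malg_mul << c *g q >> << d *g p >> =
  if comp q p is Some r then << c * d *g r >> else 0.
Proof.
rewrite malg_mulE !lin_extU scalerA /basis_mul.
by case: comp => [r|]; rewrite ?scaler0 // -malgUZ.
Qed.

Lemma malg_ind (P : KT -> Prop) :
  P 0 -> (forall x y, P x -> P y -> P (x + y)) ->
  (forall c p, P << c *g p >>) -> forall x, P x.
Proof.
by move=> P0 PD PU x; rewrite [x]monalgE; apply: big_ind => // p _; apply: PU.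
Qed.

Lemma malg_mulA : associative malg_mul.
Proof.
move=> x y z; elim/malg_ind: x => [|x1 x2 IH1 IH2|c r].
- by rewrite !malg_mul0l.
- by rewrite !malg_mulDl IH1 IH2.
elim/malg_ind: y => [|y1 y2 IH1 IH2|d q].
- by rewrite malg_mul0l malg_mul0r malg_mul0l.
- by rewrite malg_mulDl malg_mulDr IH1 IH2 (malg_mulDr _ y1) -malg_mulDl.
elim/malg_ind: z => [|z1 z2 IH1 IH2|e p].
- by rewrite !malg_mul0r.
- by rewrite malg_mulDr (malg_mulDr << c *g r >>) IH1 IH2 -malg_mulDr.
rewrite !malg_mulUU; have := compA r q p.
case: (comp q p) => [w|]; case: (comp r q) => [w'|] /= h;
  rewrite ?malg_mul0l ?malg_mul0r // malg_mulUU.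
- by rewrite malg_mulUU h mulrA.
- by rewrite h.
- by rewrite -h.
Qed.

Lemma malg_mulZl (c : K) x y : malg_mul (c *: x) y = c *: malg_mul x y.
Proof.
rewrite !malg_mulE (lin_extw _ (msuppZ_le c x)) /lin_ext scaler_sumr.
by apply: eq_bigr => p _; rewrite mcoeffZ scalerA.
Qed.

Lemma malg_mulZr (c : K) x y : malg_mul x (c *: y) = c *: malg_mul x y.
Proof.
rewrite !malg_mulE /lin_ext scaler_sumr; apply: eq_bigr => p _.
rewrite [RHS]scalerA mulrC -scalerA; congr (_ *: _).
rewrite -/(lin_ext _ _) (lin_extw _ (msuppZ_le c y)) /lin_ext scaler_sumr.
by apply: eq_bigr => q _; rewrite mcoeffZ scalerA.
Qed.

Lemma malg_mul1l : left_id malg_one malg_mul.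
Proof.
move=> x; elim/malg_ind: x => [|x y IH1 IH2|c p].
- exact: malg_mul0r.
- by rewrite malg_mulDr IH1 IH2.
rewrite malg_mulE /malg_one lin_ext_sum (bigD1 (cod p)) //=.
rewrite !lin_extU /basis_mul comp1l eqxx scale1r -malgUZ big1 ?addr0 //.
by move=> e /negPf ne; rewrite !lin_extU comp1l ne !scaler0.
Qed.

Lemma malg_mul1r : right_id malg_one malg_mul.
Proof.
move=> x; elim/malg_ind: x => [|x y IH1 IH2|c p].
- exact: malg_mul0l.
- by rewrite malg_mulDl IH1 IH2.
rewrite malg_mulE /malg_one lin_extU lin_ext_sum (bigD1 (dom p)) //=.
rewrite !lin_extU /basis_mul comp1r eqxx scale1r big1 ?addr0 -?malgUZ //.
by move=> e ne; rewrite !lin_extU comp1r eq_sym (negPf ne) !scaler0.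
Qed.

End PartialMonoidAlgebra.

Definition pathalg (K : fieldType) (G : quiver) : Type := {malg K[qpath G]}.

HB.instance Definition _ (K : fieldType) (G : quiver) :=
  GRing.Lmodule.copy (pathalg K G) {malg K[qpath G]}.

HB.instance Definition _ (K : fieldType) (G : quiver) :=
  GRing.Zmodule_isPzRing.Build (pathalg K G)
    (malg_mulA (@pcompA G)) (malg_mul1l (@pcomp_vl G))
    (malg_mul1r (@pcomp_vr G)) (malg_mulDl (@pcomp G)) (malg_mulDr (@pcomp G)).

Definition path_elt (K : fieldType) (G : quiver) (p : qpath G) : pathalg K G :=
  << (1 : K) *g p >>.

Definition path_coeff (K : fieldType) (G : quiver) (x : pathalg K G)
  (p : qpath G) : K := mcoeff p (x : {malg K[qpath G]}).

Lemma path_eltM (K : fieldType) (G : quiver) (q p : qpath G) :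
  path_elt K q * path_elt K p =
  if pcomp q p is Some r then path_elt K r else 0.
Proof.
by refine (etrans (malg_mulUU (@pcomp G) 1 1 q p) _); rewrite mulr1.
Qed.

Lemma pathalg_scalerAl (K : fieldType) (G : quiver) (c : K) (x y : pathalg K G) :
  c *: (x * y) = (c *: x) * y.
Proof. exact: (esym (malg_mulZl (@pcomp G) c x y)). Qed.

Lemma pathalg_scalerAr (K : fieldType) (G : quiver) (c : K) (x y : pathalg K G) :
  c *: (x * y) = x * (c *: y).
Proof. exact: (esym (malg_mulZr (@pcomp G) c x y)). Qed.

Section Admissible.
Context {K : fieldType} {G : quiver}.
Local Notation KG := (pathalg K G).

(* The m-th power of the ideal generated by the arrows, that is, the span of   *)
(* the paths of length at least m.                                             *)
Definition arrow_ideal_pow (m : nat) (x : KG) : Prop :=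
  forall p, path_coeff x p != 0 -> (m <= plen p)%N.

Definition two_sided_ideal (I : KG -> Prop) : Prop :=
  [/\ I 0, forall x y, I x -> I y -> I (x + y)
    & forall x y, I y -> I (x * y) /\ I (y * x)].

Definition admissible (I : KG -> Prop) : Prop :=
  [/\ two_sided_ideal I, forall x, I x -> arrow_ideal_pow 2 x
    & exists2 N, (2 <= N)%N & forall x, arrow_ideal_pow N x -> I x].

Definition quotient_map (I : KG -> Prop) (L : pzRingType)
    (pi : {rmorphism KG -> L}) : Prop :=
  (forall r, exists x, pi x = r) /\ (forall x, pi x = 0 <-> I x).

End Admissible.

Section Modules.
Context {L : pzRingType}.

Definition included (T : Type) (S S' : T -> Prop) : Prop := forall x, S x -> S' x.

Definition submodule (U : lmodType L) (S : U -> Prop) : Prop :=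
  [/\ S 0, forall x y, S x -> S y -> S (x + y)
    & forall (r : L) x, S x -> S (r *: x)].

Definition maximal_submodule (U : lmodType L) (S : U -> Prop) : Prop :=
  [/\ submodule S, exists x, ~ S x
    & forall S' : U -> Prop, submodule S' -> included S S' ->
        included S' S \/ forall x, S' x].

Definition jacobson (r : L) : Prop :=
  forall S : L^o -> Prop, maximal_submodule S -> S r.

(* [Jpow U j] is the submodule J^j U. *)
Fixpoint Jpow (U : lmodType L) (j : nat) : U -> Prop :=
  if j is j'.+1 then fun x =>
    exists (n : nat) (r : 'I_n -> L) (y : 'I_n -> U),
      (forall i, jacobson (r i) /\ Jpow j' (y i)) /\ x = \sum_i r i *: y i
  else fun=> True.

Definition finitely_generated (U : lmodType L) : Prop :=
  exists (n : nat) (g : 'I_n -> U), forall x, exists c : 'I_n -> L,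
    x = \sum_i c i *: g i.

Definition uniserial (U : lmodType L) : Prop :=
  finitely_generated U /\
  forall S S' : U -> Prop, submodule S -> submodule S' ->
    included S S' \/ included S' S.

Definition composition_length (U : lmodType L) (n : nat) : Prop :=
  exists M : nat -> U -> Prop,
  [/\ forall i, (i <= n)%N -> submodule (M i),
      forall x, M 0%N x <-> x = 0,
      forall x, M n x
    & forall i, (i < n)%N ->
        [/\ included (M i) (M i.+1), ~ included (M i.+1) (M i)
          & forall S : U -> Prop, submodule S ->
              included (M i) S -> included S (M i.+1) ->
              included S (M i) \/ included (M i.+1) S]].

Definition isomorphic (U W : lmodType L) : Prop :=
  exists f : {linear U -> W}, bijective f.

End Modules.

Definition finite_uniserial_type (L : pzRingType) : Prop :=
  exists (n : nat) (W : 'I_n -> lmodType L),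
    forall U : lmodType L, uniserial U -> exists i, isomorphic U (W i).

From mathcomp.multinomials Require Import mpoly.

Section Uniserial.
Context {K : fieldType} {G : quiver} {L : pzRingType}.
Variable pi : {rmorphism pathalg K G -> L}.
Implicit Types (p u v : qpath G) (a : arrow G).

Definition is_mast (U : lmodType L) p : Prop :=
  [/\ uniserial U, composition_length U (plen p).+1
    & exists x : U, pi (path_elt K p) *: x != 0].

Definition top_element (U : lmodType L) (x : U) : Prop :=
  ~ Jpow 1 x /\ exists e : vertex G, x = pi (path_elt K (pvertex e)) *: x.

(* The element (a u) x. *)
Definition detour_value (U : lmodType L) (x : U) a u : U :=
  pi (path_elt K (parrow a) * path_elt K u) *: x.

Definition in_V p (k : {ffun detour_index p -> K}) : Prop :=
  exists (U : lmodType L) (x : U),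
  [/\ is_mast U p, top_element x
    & forall a u, detour p a u ->
        detour_value x a u =
        \sum_(d : detour_index p | didx_detour d == (a, u))
           pi (k d *: path_elt K (didx_path d)) *: x].

(* [{mpoly K[n]}] is ambiguous here, as monalg uses it for another type.       *)
Local Notation polyD p := (mpoly #|detour_index p| K).

(* The defining ideal of the coordinate ring A_p: [vanishes_on_V f] says that  *)
(* the image of f in A_p is 0.                                                 *)
Definition vanishes_on_V p (f : polyD p) : Prop :=
  forall k, in_V k -> f.@[fun i => k (enum_val i)] = 0.

Definition detour_var p (d : detour_index p) : polyD p :=
  'X_(enum_rank d).

Definition halyard p a u : Prop :=
  detour p a u /\
  exists2 d : detour_index p, didx_detour d = (a, u)
    & ~ vanishes_on_V (detour_var d).

Definition transcendental_in_A p (f : polyD p) : Prop :=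
  forall h : {poly K}, h != 0 ->
    ~ vanishes_on_V ((map_poly (@mpolyC _ K) h).[f]).

Definition slack_halyard p a u : Prop :=
  halyard p a u /\
  exists2 d : detour_index p, didx_detour d = (a, u)
    & transcendental_in_A (detour_var d).

End Uniserial.

(* A layered graph has one node in each layer 0, 1, ..., whose names are       *)
(* listed in [lnodes]; [ledge a i j] is an edge labeled a joining the layers   *)
(* i < j.                                                                      *)
Record lgraph (N A : Type) := LGraph {
  lnodes : seq N;
  ledge : A -> nat -> nat -> Prop }.

Definition halyard_graph (K : fieldType) (G : quiver) (L : pzRingType)
    (pi : {rmorphism pathalg K G -> L}) (p : qpath G)
    (H : arrow G -> qpath G -> Prop) (U : lmodType L) (x : U) :
    lgraph (vertex G) (arrow G) :=
  LGraph (pnodes p) (fun a i j =>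
    (onth (parrows p) i = Some a /\ j = i.+1) \/
    (exists u, [/\ H a u, i = plen u, detour_value pi x a u != 0
       & forall y : U, Jpow j y <-> exists r : L, y = r *: detour_value pi x a u])).

(* The vertices and the arrow labels of the displayed graphs are only names,   *)
(* so a graph over a quiver is compared with them after an injective renaming  *)
(* of its vertices and arrows; layers are preserved. The endpoint conditions   *)
(* on the labels are automatic: an edge labeled a of a halyard graph joins a   *)
(* node src a to a node tgt a.                                                 *)
Definition subgraph_of (G : quiver) (X : lgraph (vertex G) (arrow G))
    (Y : lgraph nat nat) : Prop :=
  exists (f : vertex G -> nat) (g : arrow G -> nat),
  [/\ injective f, injective g, prefix (map f (lnodes X)) (lnodes Y)
    & forall a i j, ledge X a i j -> ledge Y (g a) i j].

Definition lgraph_of_seq (N : Type) (A : eqType) (s : seq N)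
    (E : seq (A * nat * nat)) : lgraph N A :=
  LGraph s (fun a i j => (a, i, j) \in E).

(* In graphs A and B the arguments w, w', w'' name the unlabeled edges. *)
Definition graph_A (w w' w'' alpha : nat) : lgraph nat nat :=
  lgraph_of_seq [:: 1; 1; 1; 2; 3]%N
    [:: (w, 0, 1); (w', 1, 2); (alpha, 2, 3); (w'', 3, 4);
        (alpha, 1, 3)]%N.

Definition graph_B (w w' w'' alpha : nat) : lgraph nat nat :=
  lgraph_of_seq [:: 1; 1; 1; 1; 2]%N
    [:: (w, 0, 1); (w', 1, 2); (w'', 2, 3); (alpha, 3, 4);
        (alpha, 1, 4); (alpha, 2, 4)]%N.

Definition graph_C (alpha beta gamma : nat) : lgraph nat nat :=
  lgraph_of_seq [:: 1; 2; 1; 2; 3]%N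
    [:: (alpha, 0, 1); (beta, 1, 2); (alpha, 2, 3); (gamma, 3, 4);
        (gamma, 1, 4)]%N.

(* Main.v *)
(** A top element x of a uniserial module with mast p yields the basis of the
    elements ux, u a right subpath of p, on which Lambda acts by lower triangular
    matrices. Let delta be an arrow from the vertex e(i) of layer i to the vertex
    e(j) of layer j. Adding a multiple of the matrix unit E_(j,i) to the action of
    delta on the subquotient with layers i, ..., j does not affect paths of length
    at least 2, so the result is again annihilated by I: this is a one-parameter
    family of uniserial Lambda-modules. If Lambda has finite uniserial type, two
    members are isomorphic, and comparing them rules out
    - that delta is not the arrow of p leaving layer i while e(i) does not recur
      strictly between the layers i and j (so parallel arrows along p coincide);
    - vertices a, a, b, b with a <> b in four consecutive layers.
    If (alpha, u) is slack, finite type also forces two top elements of one module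
    to have different coordinates at (alpha, u); hence e(0) = e(r) for some r with
    0 < r < length p - length u. For length p <= 4 and length u > 0 only the three
    graphs survive these restrictions. *)
From HB Require Import structures.
From mathcomp Require Import all_boot all_order all_algebra finmap ring zify.
From mathcomp.multinomials Require Import mpoly monalg.
From Stdlib Require Import Classical.
Require Import Defs.

Set Implicit Arguments.
Unset Strict Implicit.
Unset Printing Implicit Defensive.

Import GRing.Theory.
Local Open Scope ring_scope.

(** * Path algebras *)

(** Count layers from i and put m = j - i. An isomorphism between the members with parameters [c]
    and [c'] sends x_0 to a vector z supported in the layers at the vertex [e 0], because it
    commutes with the action of the vertices. In the source, delta x_0 is a combination of the x_k,
    that is, of mast paths applied to x_0; the isomorphism carries this equation to z in the target,
    where the mast paths act as before. At x_m it leaves the nonzero term [(c - c') z_0], which only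
    coordinates z_b with b > 0 can balance. So recurrence of [e 0] is the only way out; for a, a, b,
    b a second row of the equation kills the one z_b that is available.

    The bound on r has a similar origin. Up to a scalar, two top elements differ by a combination of
    elements x_r with e(r) = e(0) and r > 0, and both alpha u and the longer right subpaths move x_r
    to layers beyond r + length u. There is nothing there unless r + length u < length p. *)

Section PathAlgebra.
Context (K : fieldType) (G : quiver).
Local Notation KG := (pathalg K G).
Implicit Types (f g : KG) (p q r : qpath G) (a : arrow G) (e : vertex G).

Lemma pathalg_expand f :
  f = \sum_(p <- msupp (f : {malg K[qpath G]})) path_coeff f p *: path_elt K p.
Proof.
rewrite [LHS](@monalgE _ _ (f : {malg K[qpath G]})).
by apply: eq_bigr => p _; rewrite (malgUZ (path_coeff f p) p).
Qed.

Lemma pathalg_ind (P : KG -> Prop) :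
  P 0 -> (forall f g, P f -> P g -> P (f + g)) ->
  (forall c p, P (c *: path_elt K p)) -> forall f, P f.
Proof.
by move=> P0 PD PU f; rewrite [f]pathalg_expand; apply: big_ind => // p _.
Qed.

Lemma path_coeff0 p : path_coeff (0 : KG) p = 0.
Proof. exact: mcoeff0. Qed.

Lemma path_coeffD f g p : path_coeff (f + g) p = path_coeff f p + path_coeff g p.
Proof. exact: mcoeffD. Qed.

Lemma path_coeffZ c f p : path_coeff (c *: f) p = c * path_coeff f p.
Proof. exact: mcoeffZ. Qed.

Lemma path_coeff_elt q p : path_coeff (path_elt K q) p = (q == p)%:R.
Proof. by rewrite /path_coeff /path_elt mcoeffU. Qed.

Lemma path_coeff_sum (J : Type) (s : seq J) (P : pred J) (F : J -> KG) p :
  path_coeff (\sum_(j <- s | P j) F j) p = \sum_(j <- s | P j) path_coeff (F j) p.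
Proof.
exact: (big_morph (fun f => path_coeff f p) (fun f g => path_coeffD f g p)
  (path_coeff0 p)).
Qed.

Lemma pathalg1E : 1 = \sum_e path_elt K (pvertex e) :> KG.
Proof. by []. Qed.

Lemma path_coeffM_ext p (B : KG -> KG -> K) :
  (forall f f' g, B (f + f') g = B f g + B f' g) ->
  (forall f g g', B f (g + g') = B f g + B f g') ->
  (forall c f g, B (c *: f) g = c * B f g) ->
  (forall c f g, B f (c *: g) = c * B f g) ->
  (forall q r, path_coeff (path_elt K q * path_elt K r) p =
     B (path_elt K q) (path_elt K r)) ->
  forall f g, path_coeff (f * g) p = B f g.
Proof.
move=> BDl BDr BZl BZr Bpq f g.
have B0l h : B 0 h = 0 by rewrite -(scale0r (0 : KG)) BZl mul0r.
have B0r h : B h 0 = 0 by rewrite -(scale0r (0 : KG)) BZr mul0r.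
elim/pathalg_ind: f => [|f f' IH IH'|c q].
- by rewrite mul0r path_coeff0 B0l.
- by rewrite mulrDl path_coeffD IH IH' BDl.
elim/pathalg_ind: g => [|g g' IH IH'|d r].
- by rewrite mulr0 path_coeff0 B0r.
- by rewrite mulrDr path_coeffD IH IH' BDr.
by rewrite -pathalg_scalerAl -pathalg_scalerAr !path_coeffZ Bpq BZl BZr.
Qed.

Lemma path_coeffM_elt q r p : path_coeff (path_elt K q * path_elt K r) p =
  (pcomp q r == Some p)%:R.
Proof.
rewrite path_eltM; case: (pcomp q r) => [w|]; last by rewrite path_coeff0.
by rewrite path_coeff_elt.
Qed.

Lemma qpathE p q : (p == q) = (pstart p == pstart q) && (parrows p == parrows q).
Proof. by rewrite -val_eqE; case: p q => [[v s] ?] [[w t] ?]. Qed.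

Lemma eq_pvertex p e : (p == pvertex e) = (pstart p == e) && (parrows p == [::]).
Proof. exact: qpathE. Qed.

Lemma eq_parrow p a : (p == parrow a) = (pstart p == src a) && (parrows p == [:: a]).
Proof. exact: qpathE. Qed.

(** A path of length 0 has only the trivial factorization. *)
Lemma path_coeffM_vertex f g e : path_coeff (f * g) (pvertex e) =
  path_coeff f (pvertex e) * path_coeff g (pvertex e).
Proof.
pose B f g := path_coeff f (pvertex e) * path_coeff g (pvertex e).
apply: (path_coeffM_ext (B := B)); rewrite /B /=.
- by move=> *; rewrite path_coeffD mulrDl.
- by move=> *; rewrite path_coeffD mulrDr.
- by move=> *; rewrite path_coeffZ mulrA.
- by move=> *; rewrite path_coeffZ mulrCA.
move=> q r; apply: etrans (path_coeffM_elt q r _) _; apply: esym.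
apply: etrans (congr2 *%R (path_coeff_elt q _) (path_coeff_elt r _)) _.
apply: esym; rewrite -natrM mulnb; congr (nat_of_bool _)%:R.
rewrite pcompE !eq_pvertex /pend /walk_end -[pstart (pvertex e)]/e.
rewrite -[parrows (pvertex e)]/[::].
case: (parrows r) => [|a s] /=; last by rewrite !andbF.
case: (parrows q) => [|a s] /=; last by rewrite !andbF.
by rewrite !andbT eq_sym; case: eqP => [->|ne]; rewrite ?andbT //= ?andbb //;
  case: eqP => // e1; case: eqP => // e2; case: ne; rewrite ?e1 ?e2.
Qed.

(** An arrow factors only as itself times one of its end vertices. This Leibniz rule is what makes
    the deformed action multiplicative. *)
Lemma path_coeffM_arrow f g a : path_coeff (f * g) (parrow a) =
  path_coeff f (pvertex (tgt a)) * path_coeff g (parrow a) +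
  path_coeff f (parrow a) * path_coeff g (pvertex (src a)).
Proof.
pose B f g := path_coeff f (pvertex (tgt a)) * path_coeff g (parrow a) +
  path_coeff f (parrow a) * path_coeff g (pvertex (src a)).
apply: (path_coeffM_ext (B := B)); rewrite /B /=.
- by move=> *; rewrite !path_coeffD !mulrDl addrACA.
- by move=> *; rewrite !path_coeffD !mulrDr addrACA.
- by move=> *; rewrite !path_coeffZ mulrDr !mulrA.
- by move=> *; rewrite !path_coeffZ mulrDr; congr (_ + _); rewrite mulrCA.
move=> q r; apply: etrans (path_coeffM_elt q r _) _; apply: esym.
apply: etrans (congr2 +%R (congr2 *%R (path_coeff_elt q _) (path_coeff_elt r _))
                 (congr2 *%R (path_coeff_elt q _) (path_coeff_elt r _))) _.
apply: esym; rewrite pcompE !eq_pvertex !eq_parrow /pend /walk_end.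
rewrite -[pstart (parrow a)]/(src a) -[parrows (parrow a)]/[:: a].
case: (parrows r) => [|b [|b' s]]; last first.
- by rewrite !eqseq_cons !andbF !mulr0 addr0.
- case: (parrows q) => [|c s]; last first.
    by rewrite !eqseq_cons !andbF mulr0 mul0r addr0.
  rewrite /= !eqseq_cons !andbF !andbT !mulr0 addr0 -natrM mulnb.
  congr (nat_of_bool _)%:R.
  case: (eqVneq a b) => [->|ne]; first by rewrite !andbT [src b == _]eq_sym.
  by rewrite !andbF.
case: (parrows q) => [|c s]; first by rewrite !andbF mulr0 mul0r addr0.
rewrite !andbF mulr0 add0r !andbT -natrM mulnb.
congr (nat_of_bool _)%:R; rewrite /= eqseq_cons [a == _]eq_sym [[::] == _]eq_sym.
rewrite [src a == _]eq_sym; case: (eqVneq (pstart r) (src a)) => [->|ne].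
  by rewrite !andbT.
by rewrite !andbF.
Qed.

Lemma path_coeff1_arrow a : path_coeff (1 : KG) (parrow a) = 0.
Proof.
rewrite pathalg1E path_coeff_sum big1 // => e _.
by rewrite path_coeff_elt eq_parrow andbF.
Qed.

Lemma arrow_ideal_pow_add m f g :
  arrow_ideal_pow m f -> arrow_ideal_pow m g -> arrow_ideal_pow m (f + g).
Proof.
move=> hf hg p; rewrite path_coeffD.
by have [->|/hf //] := eqVneq (path_coeff f p) 0; rewrite add0r; apply: hg.
Qed.

Lemma arrow_ideal_pow_sum m (J : eqType) (s : seq J) (F : J -> KG) :
  (forall j, j \in s -> arrow_ideal_pow m (F j)) ->
  arrow_ideal_pow m (\sum_(j <- s) F j).
Proof.
move=> h; rewrite big_seq; apply: big_ind => //.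
- by move=> p; rewrite path_coeff0 eqxx.
- exact: arrow_ideal_pow_add.
Qed.

Lemma arrow_ideal_pow_scale m c f : arrow_ideal_pow m f -> arrow_ideal_pow m (c *: f).
Proof.
move=> h p; rewrite path_coeffZ => h0; apply: h.
by apply/eqP=> f0; rewrite f0 mulr0 eqxx in h0.
Qed.

Lemma arrow_ideal_pow_elt p m : (m <= plen p)%N -> arrow_ideal_pow m (path_elt K p).
Proof.
by move=> h q; rewrite path_coeff_elt; have [<- //|_] := eqVneq p q; rewrite eqxx.
Qed.

Lemma plen_comp q p r : pcomp q p = Some r -> plen r = (plen p + plen q)%N.
Proof.
move/eqP; rewrite pcompE => /and3P[_ _ /eqP h].
by rewrite /plen h size_cat.
Qed.

Lemma mem_msupp_coeff f p : p \in msupp (f : {malg K[qpath G]}) -> path_coeff f p != 0.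
Proof. by rewrite -mcoeff_neq0. Qed.

Lemma arrow_ideal_powM m n f g :
  arrow_ideal_pow m f -> arrow_ideal_pow n g -> arrow_ideal_pow (m + n) (f * g).
Proof.
move=> hf hg; rewrite [f]pathalg_expand mulr_suml; apply: arrow_ideal_pow_sum.
move=> q /mem_msupp_coeff/hf lq; rewrite [g]pathalg_expand mulr_sumr.
apply: arrow_ideal_pow_sum => p /mem_msupp_coeff/hg lp.
rewrite -pathalg_scalerAl -pathalg_scalerAr; do 2! apply: arrow_ideal_pow_scale.
rewrite path_eltM; case E: (pcomp q p) => [r|].
  by apply: arrow_ideal_pow_elt; rewrite (plen_comp E) addnC leq_add.
by move=> r; rewrite path_coeff0 eqxx.
Qed.

Lemma arrow_ideal_pow0 f : arrow_ideal_pow 0 f.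
Proof. by []. Qed.

Lemma arrow_ideal_powX f n : arrow_ideal_pow 1 f -> arrow_ideal_pow n (f ^+ n).
Proof.
move=> hf; elim: n => [|n IH]; first exact: arrow_ideal_pow0.
by rewrite exprS -add1n; apply: arrow_ideal_powM.
Qed.

Definition vertex_part f : KG :=
  \sum_e path_coeff f (pvertex e) *: path_elt K (pvertex e).

Lemma path_coeff_vertex_part f e :
  path_coeff (vertex_part f) (pvertex e) = path_coeff f (pvertex e).
Proof.
rewrite path_coeff_sum.
rewrite (eq_bigr (fun e' => path_coeff f (pvertex e') * (e' == e)%:R)); last first.
  by move=> e' _; rewrite path_coeffZ path_coeff_elt eq_pvertex andbT.
rewrite (bigD1 e) //= eqxx mulr1 big1 ?addr0 // => e' /negPf ->.
exact: mulr0.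
Qed.

Lemma path_coeffB f g p : path_coeff (f - g) p = path_coeff f p - path_coeff g p.
Proof. exact: mcoeffB. Qed.

Lemma arrow_part f : arrow_ideal_pow 1 (f - vertex_part f).
Proof.
move=> p; have [lp|//] := posnP (plen p).
have -> : p = pvertex (pstart p).
  by apply/eqP; rewrite eq_pvertex eqxx -size_eq0 -/(plen p) lp.
by rewrite path_coeffB path_coeff_vertex_part subrr eqxx.
Qed.

End PathAlgebra.

(** * Modules from matrix representations *)

Section RepModule.
Context (K : fieldType) (G : quiver) (I : pathalg K G -> Prop) (L : pzRingType).
Context (pi : {rmorphism pathalg K G -> L}) (n : nat).
Local Notation KG := (pathalg K G).

Record matrix_rep (rho : KG -> 'M[K]_n) : Prop := MatrixRep {
  matrix_repD : {morph rho : f g / f + g};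
  matrix_repM : forall f g, rho (f * g) = rho f *m rho g;
  matrix_rep1 : rho 1 = 1%:M;
  matrix_rep_ker : forall f, I f -> rho f = 0 }.

Context (piI : quotient_map I pi) (rho : KG -> 'M[K]_n) (rhoP : matrix_rep rho).

(** The alias carries the two proofs from which its L-module structure is inferred. *)
Definition rep_mod of quotient_map I pi & matrix_rep rho : Type := 'cV[K]_n.
HB.instance Definition _ := GRing.Zmodule.copy (rep_mod piI rhoP) 'cV[K]_n.

Fact lift_subproof (r : L) : exists f : KG, pi f == r.
Proof. by have [f <-] := piI.1 r; exists f. Qed.

Definition lift (r : L) : KG := xchoose (lift_subproof r).

Lemma liftK r : pi (lift r) = r.
Proof. exact/eqP/(xchooseP (lift_subproof r)). Qed.

Lemma matrix_repN f : rho (- f) = - rho f.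
Proof.
have rho0 : rho 0 = 0.
  by apply: (addrI (rho 0)); rewrite -(matrix_repD rhoP) !addr0.
by apply: (addrI (rho f)); rewrite -(matrix_repD rhoP) !subrr.
Qed.

(** The kernel of [pi] is [I], where [rho] vanishes; so the action of L does not depend on the
    preimage chosen by [lift]. *)
Lemma matrix_rep_pi f g : pi f = pi g -> rho f = rho g.
Proof.
move=> e; apply/eqP; rewrite -subr_eq0 -matrix_repN -(matrix_repD rhoP); apply/eqP.
by apply: matrix_rep_ker => //; apply/(piI.2); rewrite rmorphB e subrr.
Qed.

Definition rep_scale (r : L) (v : rep_mod piI rhoP) : rep_mod piI rhoP :=
  rho (lift r) *m (v : 'cV[K]_n).

Fact rep_scaleA r s v : rep_scale r (rep_scale s v) = rep_scale (r * s) v.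
Proof.
rewrite /rep_scale mulmxA -(matrix_repM rhoP); congr (_ *m _).
by apply: matrix_rep_pi; rewrite rmorphM !liftK.
Qed.

Fact rep_scale1 : left_id 1 rep_scale.
Proof.
move=> v; rewrite /rep_scale (@matrix_rep_pi (lift 1) 1) ?(matrix_rep1 rhoP) ?mul1mx //.
by rewrite liftK rmorph1.
Qed.

Fact rep_scaleDr : right_distributive rep_scale +%R.
Proof. by move=> r v w; apply: mulmxDr. Qed.

Fact rep_scaleDl v : {morph rep_scale^~ v : r s / r + s}.
Proof.
move=> r s; rewrite /rep_scale (@matrix_rep_pi (lift (r + s)) (lift r + lift s)).
  by rewrite (matrix_repD rhoP) mulmxDl.
by rewrite rmorphD !liftK.
Qed.

HB.instance Definition _ := GRing.Zmodule_isLmodule.Build L (rep_mod piI rhoP)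
  rep_scaleA rep_scale1 rep_scaleDr rep_scaleDl.

Lemma rep_modE f (v : rep_mod piI rhoP) : pi f *: v = rho f *m (v : 'cV[K]_n).
Proof.
by congr (_ *m _); apply: matrix_rep_pi; rewrite liftK.
Qed.

End RepModule.

(** * Infinitely many parameters, finitely many isomorphism classes *)

Section FiniteType.
Context (K : fieldType) (L : pzRingType).
Hypothesis infK : forall s : seq K, exists c : K, c \notin s.

Lemma infinite_uniq_seq N : exists2 s : seq K, uniq s & size s = N.
Proof.
elim: N => [|N [s us ss]]; first by exists [::].
by have [c cs] := infK s; exists (c :: s); rewrite /= ?cs ?ss.
Qed.

Lemma finite_type_pigeonhole (F : K -> lmodType L) :
  finite_uniserial_type L -> (forall c, uniserial (F c)) ->
  exists c c', c != c' /\ exists phi : F c -> F c',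
  [/\ {morph phi : x y / x + y}, forall r x, phi (r *: x) = r *: phi x
    & injective phi].
Proof.
move=> [n [W WP]] FU; have [s us ss] := infinite_uniq_seq n.+1.
have sel (k : 'I_n.+1) : exists i, isomorphic (F s`_k) (W i) by apply: WP.
have {sel} [h hP] := fin_all_exists sel.
have /injectivePn[i [j ij hij]] : ~~ injectiveb h.
  by apply/injectiveP => /leq_card; rewrite !card_ord ltnn.
exists s`_i, s`_j; rewrite nth_uniq ?ss // ij; split=> //.
have [f [f' fK fK']] := hP i; have [g [g' gK gK']] := hP j.
move: f f' fK fK'; rewrite hij => f f' fK fK'.
exists (g' \o f); split=> [x y|r x|] /=.
- by apply: (can_inj gK); rewrite gK' !linearD !gK'.
- by apply: (can_inj gK); rewrite gK' !linearZ /= !gK'.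
- by apply: inj_comp; [apply: can_inj gK' | apply: can_inj fK].
Qed.

End FiniteType.

(** * Representations along a mast and their deformations *)

Section Urep.
Context (K : fieldType) (G : quiver) (I : pathalg K G -> Prop).
Local Notation KG := (pathalg K G).
Local Notation arr a := (path_elt K (parrow a)).
Local Notation vert e := (path_elt K (pvertex e)).

(* [R f] is the matrix of the action of [f] on a basis x_0, ..., x_m, where x_k   *)
(* sits in layer k at the vertex [e k] and x_(k+1) = (A k) x_k. Only the entries *)
(* with indices at most [m] are meaningful.                                      *)
Record urep m (e : nat -> vertex G) (A : nat -> arrow G)
    (R : KG -> nat -> nat -> K) : Prop := Urep {
  urepD : forall f g a b, R (f + g) a b = R f a b + R g a b;
  urepZ : forall c f a b, R (c *: f) a b = c * R f a b;
  urepM : forall f g a b, (a <= m)%N -> (b <= m)%N ->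
    R (f * g) a b = \sum_(0 <= k < m.+1) R f a k * R g k b;
  urep1 : forall a b, (a <= m)%N -> (b <= m)%N -> R 1 a b = (a == b)%:R;
  urep_ker : forall f a b, I f -> (a <= m)%N -> (b <= m)%N -> R f a b = 0;
  urep_trig : forall f a b, (a < b)%N -> (b <= m)%N -> R f a b = 0;
  urep_diag : forall f a, (a <= m)%N -> R f a a = path_coeff f (pvertex (e a));
  urep_vertex : forall x a b, (a <= m)%N -> (b <= m)%N ->
    R (vert x) a b = ((a == b) && (e a == x))%:R;
  urep_mast : forall k a, (k < m)%N -> (a <= m)%N -> R (arr (A k)) a k = (a == k.+1)%:R;
  urep_src : forall k, (k < m)%N -> src (A k) = e k;
  urep_tgt : forall k, (k < m)%N -> tgt (A k) = e k.+1 }.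

Lemma sum_nat_delta n j (X : nat -> K) : (j < n)%N ->
  \sum_(0 <= k < n) (k == j)%:R * X k = X j.
Proof.
move=> lj; rewrite (bigD1_seq j) ?mem_index_iota ?iota_uniq //= eqxx mul1r.
by rewrite big1 ?addr0 // => k /negPf ->; rewrite mul0r.
Qed.

(** This is the diagonal block on the layers i, ..., i + m. By triangularity, indices outside the
    block contribute nothing to a product, so the subquotient is again a representation. *)
Lemma urep_segment M e A R i m : urep M e A R -> (i + m <= M)%N ->
  urep m (fun k => e (i + k)%N) (fun k => A (i + k)%N)
    (fun f a b => R f (i + a)%N (i + b)%N).
Proof.
move=> h le; have l2 a : (a <= m)%N -> (i + a <= M)%N.
  by move=> ?; apply: leq_trans le; rewrite leq_add2l.
have l3 k : (k < m)%N -> (i + k < M)%N.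
  by move=> ?; apply: leq_trans le; rewrite ltn_add2l.
split=> //.
- by move=> *; apply: (urepD h).
- by move=> *; apply: (urepZ h).
- move=> f g a b la lb; rewrite (urepM h) ?l2 //.
  rewrite (big_cat_nat (n := i)) //=; last first.
    by rewrite ltnW // ltnS (leq_trans _ le) ?leq_addr.
  rewrite [X in X + _]big_nat_cond big1 ?add0r; last first.
    move=> k; rewrite andbT => /andP[_ lk].
    by rewrite (@urep_trig _ _ _ _ h g) ?mulr0 ?l2 // ltn_addr.
  rewrite (big_cat_nat (n := (i + m).+1)) //=; last by rewrite -addnS leq_addr.
  rewrite [X in _ + X]big_nat_cond [X in _ + X]big1 ?addr0; last first.
    move=> k; rewrite andbT => /andP[lk lM].
    rewrite (@urep_trig _ _ _ _ h f) ?mul0r //.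
    by apply: leq_trans lk; rewrite ltnS leq_add2l.
  rewrite -{1}[i]add0n big_addn subSn ?leq_addr // addKn.
  by apply: eq_bigr => k _; rewrite [(k + i)%N]addnC.
- by move=> a b la lb; rewrite (urep1 h) ?l2 // eqn_add2l.
- by move=> f a b fI la lb; rewrite (urep_ker h) ?l2.
- by move=> f a b lab lb; rewrite (urep_trig h) ?l2 // ltn_add2l.
- by move=> f a la; rewrite (urep_diag h) ?l2.
- by move=> x a b la lb; rewrite (urep_vertex h) ?l2 // eqn_add2l.
- by move=> k a lk la; rewrite (urep_mast h) ?l2 ?l3 // -addnS eqn_add2l.
- by move=> k lk; rewrite (urep_src h) ?l3.
- by move=> k lk; rewrite (urep_tgt h) ?l3 // addnS.
Qed.

Lemma path_coeff_arrow_vertex (a : arrow G) (x : vertex G) :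
  path_coeff (arr a) (pvertex x) = 0.
Proof. by rewrite path_coeff_elt eq_pvertex andbF. Qed.

Lemma path_coeff_vertex_arrow (a : arrow G) (x : vertex G) :
  path_coeff (vert x) (parrow a) = 0.
Proof. by rewrite path_coeff_elt eq_parrow andbF. Qed.

Lemma path_coeff_arrow_arrow (a b : arrow G) :
  path_coeff (arr a) (parrow b) = (a == b)%:R.
Proof.
rewrite path_coeff_elt eq_parrow /= eqseq_cons andbT; congr (nat_of_bool _)%:R.
by case: (eqVneq a b) => [->|_]; rewrite ?andbF ?andbT /pstart /= ?eqxx.
Qed.

Section Deform.
Context (m : nat) (e : nat -> vertex G) (A : nat -> arrow G).
Context (R : KG -> nat -> nat -> K).
Context (h : urep m e A R) (m0 : (0 < m)%N).

(** Arrows never reach x_0 and kill x_m, so row 0 and, in [urep_socle], column m see only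
    coefficients at vertices. A change in the corner (m, 0) therefore interacts with vertices
    only. *)
Lemma urep_top f b : (b <= m)%N -> 
  R f 0%N b = (b == 0%N)%:R * path_coeff f (pvertex (e 0%N)).
Proof.
case: b => [_|b lb]; first by rewrite mul1r (urep_diag h).
by rewrite (urep_trig h) ?mul0r.
Qed.

Lemma urep_socle f a : (a <= m)%N -> 
  R f a m = (a == m)%:R * path_coeff f (pvertex (e m)).
Proof.
rewrite leq_eqVlt => /orP[/eqP ->|lt]; first by rewrite eqxx mul1r (urep_diag h).
by rewrite (urep_trig h) // (ltn_eqF lt) mul0r.
Qed.

Lemma urep_arrow_diag d a : (a <= m)%N -> R (arr d) a a = 0.
Proof. by move=> la; rewrite (urep_diag h) // path_coeff_arrow_vertex. Qed.

Context (d : arrow G) (d_src : src d = e 0%N) (d_tgt : tgt d = e m) (dA : d != A 0%N).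

(* Adds [c] times the matrix unit E_(m, 0) to the action of the arrow [d]; paths  *)
(* of length at least 2, and hence the elements of [I], act as before.            *)
Definition deform (c : K) (f : KG) (a b : nat) : K :=
  R f a b + c * path_coeff f (parrow d) * ((a == m) && (b == 0%N))%:R.

Lemma deform_urep c : admissible I -> urep m e A (deform c).
Proof.
move=> [_ I2 _]; split; rewrite /deform.
- by move=> f g a b; rewrite (urepD h) path_coeffD mulrDr mulrDl addrACA.
- by move=> x f a b; rewrite (urepZ h) path_coeffZ mulrDr !mulrA [c * x]mulrC.
- move=> f g a b la lb; rewrite (urepM h) //.
  pose y := c * path_coeff g (parrow d) * (b == 0%N)%:R.
  pose z := c * path_coeff f (parrow d) * (a == m)%:R.
  rewrite [RHS](eq_bigr (fun k => R f a k * R g k b +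
    (k == m)%:R * (R f a k * y) + (k == 0%N)%:R * (z * R g k b))); last first.
    move=> k _; rewrite -!mulnb !natrM.
    (* The matrix unit E_(m,0) has square zero because m > 0. *)
    have uv : (k == 0%N)%:R * (k == m)%:R = 0 :> K.
      rewrite -natrM mulnb; case: (eqVneq k 0%N) => [->|//].
      by rewrite (ltn_eqF m0).
    transitivity (R f a k * R g k b + (k == m)%:R * (R f a k * y) +
      (k == 0%N)%:R * (z * R g k b) + z * y * ((k == 0%N)%:R * (k == m)%:R)).
      by rewrite /y /z; ring.
    by rewrite uv mulr0 addr0.
  (* By the Leibniz rule the two mixed terms add up to the coefficient of [f * g] at [d]. *)
  rewrite !big_split /= !sum_nat_delta // urep_socle // urep_top //.
  rewrite path_coeffM_arrow d_src d_tgt -mulnb natrM /y /z.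
  ring.
- by move=> a b la lb; rewrite (urep1 h) // path_coeff1_arrow mulr0 mul0r addr0.
- move=> f a b If la lb; rewrite (urep_ker h) //.
  (* [I] lies in the square of the arrow ideal, so its elements have no component at [d]. *)
  have -> : path_coeff f (parrow d) = 0 by apply/eqP/negP => /negP/(I2 f If).
  by rewrite mulr0 mul0r addr0.
- move=> f a b lab lb; rewrite (urep_trig h) //.
  by case: (eqVneq b 0%N) lab => [->//|_ _]; rewrite andbF mulr0 addr0.
- move=> f a la; rewrite (urep_diag h) //.
  by case: (eqVneq a m) => [->|_]; rewrite ?(gtn_eqF m0) /= mulr0 addr0.
- move=> x a b la lb.
  by rewrite (urep_vertex h) // path_coeff_vertex_arrow mulr0 mul0r addr0.
- move=> k a lk la; rewrite (urep_mast h) // path_coeff_arrow_arrow.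
  case: k lk => [|k] lk; last by rewrite andbF mulr0 addr0.
  by rewrite [A _ == d]eq_sym (negPf dA) mulr0 mul0r addr0.
- exact: (urep_src h).
- exact: (urep_tgt h).
Qed.

(** Carries x_0 to x_k. Starting from [1] instead of a vertex leaves the arrows as the only data. *)
Fixpoint mast_prefix (B : nat -> arrow G) (k : nat) : KG :=
  if k is k'.+1 then arr (B k') * mast_prefix B k' else 1.

Lemma mast_prefix_top R' k a : urep m e A R' -> (k <= m)%N -> (a <= m)%N ->
  R' (mast_prefix A k) a 0%N = (a == k)%:R.
Proof.
move=> h'; elim: k a => [|k IH] a lk la /=; first by rewrite (urep1 h').
rewrite (urepM h') // (eq_big_nat _ _ (F2 := fun j => (j == k)%:R * R' (arr (A k)) a j)).
  by rewrite sum_nat_delta ?(urep_mast h') // (leq_trans lk).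
by move=> j /andP[_ lj]; rewrite IH // 1?ltnW // mulrC.
Qed.

Lemma mast_prefix_vertex B k x : (0 < k)%N ->
  path_coeff (mast_prefix B k) (pvertex x) = 0.
Proof.
by case: k => // k _; rewrite path_coeffM_vertex path_coeff_arrow_vertex mul0r.
Qed.

(** For k = 1 this is [d != A 0]; for other k there is no component of length 1. Hence the
    deformation does not change the action of the mast. *)
Lemma mast_prefix_arrow k : path_coeff (mast_prefix A k) (parrow d) = 0.
Proof.
case: k => [|k]; first exact: path_coeff1_arrow.
rewrite [mast_prefix _ _]/= path_coeffM_arrow path_coeff_arrow_vertex mul0r add0r.
rewrite path_coeff_arrow_arrow.
case: k => [|k]; first by rewrite eq_sym (negPf dA) mul0r.
by rewrite [X in _ * X](mast_prefix_vertex A _ (ltn0Sn k)) mulr0.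
Qed.

Lemma mast_prefix_low R' k a b : urep m e A R' -> (k <= m)%N ->
  (a <= m)%N -> (b <= m)%N -> (a < b + k)%N -> R' (mast_prefix A k) a b = 0.
Proof.
move=> h'; elim: k a => [|k IH] a lk la lb lab.
  by rewrite (urep_trig h') // -[b]addn0.
rewrite /= (urepM h') // big_nat_cond big1 // => j; rewrite andbT => /andP[_ lj].
have [lt|ge] := ltnP j (b + k); first by rewrite IH ?mulr0 // 1?ltnW.
have [lt|] := ltnP a j; first by rewrite (urep_trig h') ?mul0r.
rewrite leq_eqVlt => /orP[/eqP ja|lt]; last first.
  by move: (leq_ltn_trans ge lt); rewrite ltnNge -ltnS -addnS lab.
by rewrite ja (urep_diag h') // path_coeff_arrow_vertex mul0r.
Qed.

Definition urep_mx (R' : KG -> nat -> nat -> K) (f : KG) : 'M[K]_m.+1 :=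
  \matrix_(a, b) R' f a b.

Lemma urep_matrix_rep R' : urep m e A R' -> matrix_rep I (urep_mx R').
Proof.
move=> h'; split.
- by move=> f g; apply/matrixP=> a b; rewrite !mxE (urepD h').
- move=> f g; apply/matrixP=> a b; rewrite !mxE (urepM h') ?leq_ord // big_mkord.
  by apply: eq_bigr => k _; rewrite !mxE.
- by apply/matrixP=> a b; rewrite !mxE (urep1 h') ?leq_ord.
- by move=> f If; apply/matrixP=> a b; rewrite !mxE (urep_ker h') ?leq_ord.
Qed.

End Deform.

End Urep.

(** * Submodules of a triangular representation *)

Section UrepModule.
Context (K : fieldType) (G : quiver) (I : pathalg K G -> Prop) (L : pzRingType).
Context (pi : {rmorphism pathalg K G -> L}) (piI : quotient_map I pi).
Context (m : nat) (e : nat -> vertex G) (A : nat -> arrow G).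
Context (R : pathalg K G -> nat -> nat -> K) (h : urep I m e A R).
Local Notation arr a := (path_elt K (parrow a)).
Local Notation M := (rep_mod piI (urep_matrix_rep h)).

(** The vectors supported in the layers k, ..., m; the subspaces of this form turn out to be the
    only submodules. *)
Definition low_from (k : nat) (v : 'cV[K]_m.+1) : Prop :=
  forall a : 'I_m.+1, (a < k)%N -> v a 0 = 0.

Lemma low_from_eq0 v : low_from m.+1 v -> v = 0.
Proof.
by move=> vl; apply/matrixP => a b; rewrite (ord1 b) mxE; apply: vl; apply: ltn_ord.
Qed.

Lemma leading_index v : v != 0 ->
  exists k : 'I_m.+1, low_from k v /\ v k 0 != 0.
Proof.
move=> v0; have ex : exists k, (k < m.+1)%N && (v (inord k) 0 != 0).
  apply: NNPP => nex; move/eqP: v0; apply; apply: low_from_eq0 => a _.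
  apply/eqP/negP => /negP va; apply: nex; exists a.
  by rewrite ltn_ord inord_val.
have [k /andP[lk vk] kmin] := ex_minnP ex.
exists (Ordinal lk); split; last by rewrite -(inord_val (Ordinal lk)).
move=> a /= ak; apply/eqP/negP => /negP va.
have := kmin a; rewrite ltn_ord inord_val va leqNgt ak => /(_ isT).
by [].
Qed.

Context (S : M -> Prop) (subS : submodule S).

Lemma submodule_mx f v : S v -> S (urep_mx m R f *m v).
Proof. by case: subS => _ _ SZ Sv; rewrite -[_ *m _]rep_modE; apply: SZ. Qed.

Lemma submodule_scale c (v : 'cV[K]_m.+1) : S v -> S (c *: v).
Proof.
move=> Sv; rewrite -mul_scalar_mx.
have -> : c%:M = urep_mx m R (c *: (1 : pathalg K G)).
  apply/matrixP=> a b; rewrite !mxE (urepZ h) (urep1 h) ?leq_ord //.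
  by rewrite -val_eqE /= mulr_natr.
exact: submodule_mx.
Qed.

Lemma submodule_shift (k : nat) v : (k < m)%N -> low_from k v -> S v ->
  v (inord k) 0 != 0 ->
  exists w, [/\ S w, low_from k.+1 w & w (inord k.+1) 0 != 0].
Proof.
move=> km vl Sv vk; exists (urep_mx m R (arr (A k)) *m v); split.
- exact: submodule_mx.
- move=> a ak; rewrite mxE big1 // => j _; rewrite mxE.
  have [jk|jk] := ltnP j k; first by rewrite vl ?mulr0.
  have [aj|aj] := ltnP a j; first by rewrite (urep_trig h) ?mul0r ?leq_ord.
  have -> : j = a by apply: ord_inj; lia.
  by rewrite (urep_arrow_diag h) ?mul0r ?leq_ord.
rewrite mxE (bigD1 (inord k)) //= mxE !inordK ?ltnS ?(ltnW km) //.
rewrite (urep_mast h) // eqxx mul1r big1 ?addr0 // => j jk.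
rewrite mxE inordK //.
have [lt|ge] := ltnP j k; first by rewrite vl ?mulr0.
have {}jk : (j != k :> nat).
  by apply: contraNneq jk => <-; rewrite inord_val.
have [lt|ge'] := ltnP k.+1 j; first by rewrite (urep_trig h) ?mul0r ?leq_ord.
have -> : nat_of_ord j = k.+1 by lia.
by rewrite (urep_arrow_diag h) ?mul0r.
Qed.

(** The mast arrows turn v into vectors of S with leading indices k, k+1, ..., m, and these clear
    the coordinates of w one after another. *)
Lemma submodule_low (k : nat) v : (k <= m)%N -> low_from k v -> S v ->
  v (inord k) 0 != 0 -> forall w, low_from k w -> S w.
Proof.
move=> km vl Sv vk.
have lead b : (k + b <= m)%N ->
    exists w, [/\ S w, low_from (k + b) w & w (inord (k + b)) 0 != 0].
  elim: b => [|b IH] lb; first by exists v; rewrite addn0.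
  have [|w [Sw wl wb]] := IH; first by lia.
  by rewrite addnS; apply: (submodule_shift _ wl) => //; lia.
(* Induction on the number b of coordinates that may be nonzero. *)
have low b : (b <= m.+1 - k)%N -> forall w, low_from (m.+1 - b) w -> S w.
  elim: b => [|b IH] lb w wl.
    by rewrite subn0 in wl; rewrite (low_from_eq0 wl); case: subS.
  have [|u [Su ul ub]] := lead (m - b - k)%N; first by lia.
  have e1 : (k + (m - b - k) = m - b)%N by lia.
  have e2 : (m.+1 - b.+1 = m - b)%N by lia.
  rewrite {}e1 in ul ub; rewrite {}e2 in wl.
  pose c := w (inord (m - b)) 0 / u (inord (m - b)) 0.
  have -> : w = (w - c *: u) + c *: u by rewrite subrK.
  case: (subS) => _ SD _; apply: SD; last exact: submodule_scale.
  apply: IH; first by lia.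
  move=> a la; rewrite !mxE; have [lt|ge] := ltnP a (m - b).
    by rewrite wl // ul // mulr0 subrr.
  have -> : a = inord (m - b).
    by apply: ord_inj; rewrite inordK; lia.
  by rewrite /c divfK ?subrr.
move=> w wl; apply: (low (m.+1 - k)%N) => // a la; apply: wl.
by lia.
Qed.

End UrepModule.

Section UrepUniserial.
Context (K : fieldType) (G : quiver) (I : pathalg K G -> Prop) (L : pzRingType).
Context (pi : {rmorphism pathalg K G -> L}) (piI : quotient_map I pi).
Context (m : nat) (e : nat -> vertex G) (A : nat -> arrow G).
Context (R : pathalg K G -> nat -> nat -> K) (h : urep I m e A R).

Lemma urep_uniserial : uniserial (rep_mod piI (urep_matrix_rep h)).
Proof.
split.
  (* x_0 generates the module, since its cyclic submodule contains a vector with leading index 0. *)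
  pose g : rep_mod piI (urep_matrix_rep h) := delta_mx 0 0.
  exists 1%N, (fun=> g) => x.
  pose S x := exists r : L, x = r *: g.
  suff [r ->] : S x by exists (fun=> r); rewrite big_ord1.
  have subS : submodule S.
    split; first by exists 0; rewrite scale0r.
      by move=> _ _ [r ->] [s ->]; exists (r + s); rewrite scalerDl.
    by move=> r _ [s ->]; exists (r * s); rewrite scalerA.
  apply: (@submodule_low _ _ _ _ _ _ _ _ _ _ h S subS 0%N g) => //.
  - by exists 1; rewrite scale1r.
  - have -> : inord 0 = 0 :> 'I_m.+1 by apply: ord_inj; rewrite inordK.
    by rewrite mxE !eqxx oner_eq0.
move=> S S' subS subS'; have [|nSS] := classic (included S S'); first by left.
have [v [Sv nSv]] : exists v, S v /\ ~ S' v.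
  by apply: NNPP => nex; apply: nSS => v Sv; apply: NNPP => nS; apply: nex; exists v.
have S0 : S 0 by case: subS.
have S0' : S' 0 by case: subS'.
have v0 : v != 0 by apply/eqP => v0; apply: nSv; rewrite v0.
have [k [vl vk]] := leading_index v0.
(* If w had a smaller leading index than v, the second submodule would contain v. *)
right=> w Sw; have [->//|w0] := eqVneq w 0.
have [j [wl wj]] := leading_index w0.
apply: (submodule_low subS (k := k) _ vl) => //; first by rewrite leq_ord.
  by rewrite inord_val.
move=> a ak; apply: (wl); apply: leq_trans ak _; rewrite leqNgt; apply/negP => jk.
apply: nSv; apply: (submodule_low subS' (k := j) _ wl) => //.
- by rewrite leq_ord.
- by rewrite inord_val.
- by move=> b bj; apply: (vl); apply: leq_trans bj _; apply: ltnW.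
Qed.

End UrepUniserial.

(** * Isomorphisms inside a one-parameter family *)

Section DeformFamily.
Context (K : fieldType) (G : quiver) (I : pathalg K G -> Prop) (L : pzRingType).
Context (pi : {rmorphism pathalg K G -> L}).
Hypothesis infK : forall s : seq K, exists c : K, c \notin s.
Hypotheses (admI : admissible I) (piI : quotient_map I pi).
Hypothesis finL : finite_uniserial_type L.
Local Notation KG := (pathalg K G).
Local Notation arr a := (path_elt K (parrow a)).
Local Notation vert e := (path_elt K (pvertex e)).

Section Column.
Context (m : nat) (R : KG -> nat -> nat -> K).

Lemma urep_mxE f (v : 'cV[K]_m.+1) a : (a <= m)%N ->
  (urep_mx m R f *m v) (inord a) 0 = \sum_(0 <= b < m.+1) R f a b * v (inord b) 0.
Proof.
move=> la; rewrite mxE big_mkord; apply: eq_bigr => b _.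
by rewrite mxE inordK ?inord_val.
Qed.

Lemma urep_mx_top f a : (a <= m)%N ->
  (urep_mx m R f *m (delta_mx 0 0 : 'cV[K]_m.+1)) (inord a) 0 = R f a 0%N.
Proof.
move=> la; rewrite urep_mxE // (eq_big_nat _ _ (F2 := fun b => (b == 0%N)%:R * R f a b)).
  by rewrite sum_nat_delta.
move=> b /andP[_ lb]; rewrite mulrC mxE eqxx andbT; congr ((nat_of_bool _)%:R * _).
by rewrite -val_eqE /= inordK.
Qed.

Lemma eq_col_inord (v w : 'cV[K]_m.+1) :
  (forall a, (a <= m)%N -> v (inord a) 0 = w (inord a) 0) -> v = w.
Proof.
move=> vw; apply/matrixP => a b; rewrite (ord1 b) -(inord_val a).
by apply: vw; rewrite leq_ord.
Qed.

End Column.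

Section Relation.
Context (m : nat) (e : nat -> vertex G) (A : nat -> arrow G).
Context (R : KG -> nat -> nat -> K) (h : urep I m e A R).

Context (d : arrow G).
(** Agrees with [d] on x_0 in the undeformed representation, but acts in the same way in every
    member of the family. *)
Definition mast_sum : KG :=
  \sum_(0 <= k < m.+1) R (arr d) k 0%N *: mast_prefix K A k.

Lemma mast_sumE R' a b : urep I m e A R' ->
  R' mast_sum a b =
  \sum_(0 <= k < m.+1) R (arr d) k 0%N * R' (mast_prefix K A k) a b.
Proof.
move=> h'; rewrite (big_morph (fun f => R' f a b) (id1 := 0) (op1 := +%R)).
- by apply: eq_bigr => k _; rewrite (urepZ h').
- by move=> f g; apply: (urepD h').
by rewrite -(scale0r (0 : KG)) (urepZ h') mul0r.
Qed.

Context (m0 : (0 < m)%N).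
Context (d_src : src d = e 0%N) (d_tgt : tgt d = e m) (dA : d != A 0%N).

(** The whole mast acts as E_(m,0), so [c] times it reproduces the deformation on x_0. *)
Lemma mast_prefix_full a b : (a <= m)%N -> (b <= m)%N ->
  R (mast_prefix K A m) a b = (b == 0%N)%:R * (a == m)%:R.
Proof.
case: b => [|b] la lb; first by rewrite (mast_prefix_top h) // mul1r.
by rewrite (mast_prefix_low h) ?mul0r //; lia.
Qed.

(* [z] is the image of the top basis vector x_0 under an isomorphism between two *)
(* members of the family [deform m R d]; it satisfies, in the target, the relation *)
(* [d] x_0 = \sum_k (R (arr d) k 0) x_k + c x_m of the source.                      *)
Lemma deform_relation : exists (z : nat -> K) (t : K),
  [/\ t != 0, forall b, (b <= m)%N -> z b != 0 -> e b = e 0%N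
    & forall a, (a <= m)%N ->
      \sum_(0 <= b < m.+1) (R (arr d) a b - R mast_sum a b) * z b =
      t * (a == m)%:R].
Proof.
pose Rc := deform m R d.
have hc c : urep I m e A (Rc c) := deform_urep h m0 d_src d_tgt dA c admI.
pose F c : lmodType L := rep_mod piI (urep_matrix_rep (hc c)).
have [c [c' [cc' [phi [phiD phiZ phi_inj]]]]] :=
  finite_type_pigeonhole infK finL (fun c => urep_uniserial piI (hc c)) (F := F).
pose y0 : 'cV[K]_m.+1 := delta_mx 0 0.
pose w : 'cV[K]_m.+1 := phi y0.
have phiE f : phi (urep_mx m (Rc c) f *m y0) = urep_mx m (Rc c') f *m w.
  rewrite -[_ *m y0](@rep_modE _ _ _ _ _ _ piI _ (urep_matrix_rep (hc c))) phiZ.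
  exact: rep_modE.
(* A relation satisfied by x_0 in the source holds for its image [w] in the target. *)
have transfer f g : (forall a, (a <= m)%N -> Rc c f a 0%N = Rc c g a 0%N) ->
    forall a, (a <= m)%N ->
    \sum_(0 <= b < m.+1) Rc c' f a b * w (inord b) 0 =
    \sum_(0 <= b < m.+1) Rc c' g a b * w (inord b) 0.
  move=> fg a la; rewrite -!urep_mxE // -!phiE; congr ((phi _ : 'cV[K]_m.+1) _ _).
  by apply: eq_col_inord => j lj; rewrite !urep_mx_top // fg.
pose z b := w (inord b) 0.
have Rc_prefix c0 k a b : Rc c0 (mast_prefix K A k) a b = R (mast_prefix K A k) a b.
  by rewrite /Rc /deform (mast_prefix_arrow K dA) mulr0 mul0r addr0.
have Rc_sum c0 a b : Rc c0 mast_sum a b = R mast_sum a b.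
  rewrite (mast_sumE _ _ (hc c0)) (mast_sumE _ _ h).
  by apply: eq_bigr => k _; rewrite Rc_prefix.
(* This expresses [d] x_0 in the source by mast paths alone. *)
pose g := mast_sum + c *: mast_prefix K A m.
have top_eq a : (a <= m)%N -> Rc c (arr d) a 0%N = Rc c g a 0%N.
  move=> la; rewrite (urepD (hc c)) Rc_sum (urepZ (hc c)).
  rewrite Rc_prefix mast_prefix_full // mul1r.
  rewrite /Rc /deform path_coeff_arrow_arrow !eqxx mulr1 andbT; congr (_ + _).
  rewrite (mast_sumE _ _ h).
  rewrite (eq_big_nat _ _ (F2 := fun k => (k == a)%:R * R (arr d) k 0%N)).
    by rewrite sum_nat_delta.
  by move=> k /andP[_ lk]; rewrite (mast_prefix_top h) // mulrC eq_sym.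
(* The mast sees only the coordinate z_0; if that vanished, [phi] would kill x_m. *)
have z0 : z 0%N != 0.
  apply/eqP => z0.
  have : phi (urep_mx m (Rc c) (mast_prefix K A m) *m y0) = 0.
    rewrite phiE; apply: (@eq_col_inord m) => a la.
    rewrite urep_mxE // mxE big_nat_cond big1 // => b; rewrite andbT => /andP[_ lb].
    rewrite Rc_prefix mast_prefix_full //; case: (eqVneq b 0%N) => [->|_].
      by rewrite -/(z 0%N) z0 mulr0.
    by rewrite !mul0r.
  have phi0 : phi 0 = 0 by apply: (addrI (phi 0)); rewrite -phiD !addr0.
  rewrite -phi0 => /phi_inj/(congr1 (fun v : 'cV_m.+1 => v (inord m) 0)).
  rewrite urep_mx_top // Rc_prefix mast_prefix_full // !eqxx mul1r mxE => /eqP.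
  by rewrite oner_eq0.
(* In row m of the target, [g] contributes c z_0 beyond [mast_sum], and [d] contributes c' z_0
   beyond its undeformed action. *)
exists z, ((c - c') * z 0%N); split.
- by rewrite mulf_neq0 // subr_eq0.
(* The vertex [e 0] fixes x_0, hence its image, which so has no coordinates at other vertices. *)
- move=> b lb zb; have := transfer (vert (e 0%N)) 1 _ b lb.
  have -> : \sum_(0 <= j < m.+1) Rc c' (vert (e 0%N)) b j * w (inord j) 0 =
            (e b == e 0%N)%:R * z b.
    rewrite (eq_big_nat _ _ (F2 := fun j => (j == b)%:R * ((e b == e 0%N)%:R * z j))).
      by rewrite sum_nat_delta.
    move=> j /andP[_ lj]; rewrite (urep_vertex (hc c')) // -mulnb natrM mulrA.
    by rewrite eq_sym.
  have -> : \sum_(0 <= j < m.+1) Rc c' 1 b j * w (inord j) 0 = z b.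
    rewrite (eq_big_nat _ _ (F2 := fun j => (j == b)%:R * z j)) ?sum_nat_delta //.
    by move=> j /andP[_ lj]; rewrite (urep1 (hc c')) // eq_sym.
  have [//|_] := eqVneq (e b) (e 0%N).
  rewrite mul0r => H; exfalso; move/eqP: zb; apply; apply/esym/H => a la.
  rewrite (urep_vertex (hc c)) // (urep1 (hc c)) //.
  by case: (eqVneq a 0%N) => [->|_]; rewrite ?eqxx.
move=> a la; have := transfer _ _ top_eq a la.
rewrite (eq_big_nat _ _ (F2 := fun b => R (arr d) a b * z b +
  (b == 0%N)%:R * (c' * (a == m)%:R * z b))); last first.
  move=> b _; rewrite /Rc /deform path_coeff_arrow_arrow eqxx mulr1 -mulnb natrM.
  by rewrite /z; ring.
rewrite [X in _ = X -> _](eq_big_nat _ _ (F2 := fun b => R mast_sum a b * z b +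
  (b == 0%N)%:R * (c * (a == m)%:R * z b))); last first.
  move=> b /andP[_ lb]; rewrite (urepD (hc c')) Rc_sum.
  rewrite (urepZ (hc c')) Rc_prefix mast_prefix_full //.
  by rewrite /z; ring.
rewrite !big_split /= !sum_nat_delta // => E.
rewrite (eq_bigr (fun b => R (arr d) a b * z b - R mast_sum a b * z b)); last first.
  by move=> b _; rewrite mulrBl.
rewrite sumrB; apply/eqP; rewrite -subr_eq0.
have {}E : \sum_(0 <= b < m.+1) R (arr d) a b * z b =
  \sum_(0 <= b < m.+1) R mast_sum a b * z b + c * (a == m)%:R * z 0%N -
  c' * (a == m)%:R * z 0%N by rewrite -E addrK.
by rewrite E; apply/eqP; ring.
Qed.

End Relation.
End DeformFamily.

(** * Obstructions to finite uniserial type *)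

Section Obstructions.
Context (K : fieldType) (G : quiver) (I : pathalg K G -> Prop) (L : pzRingType).
Context (pi : {rmorphism pathalg K G -> L}).
Hypothesis infK : forall s : seq K, exists c : K, c \notin s.
Hypotheses (admI : admissible I) (piI : quotient_map I pi).
Hypothesis finL : finite_uniserial_type L.
Local Notation KG := (pathalg K G).
Local Notation arr a := (path_elt K (parrow a)).

Lemma urep_arrow_eq0 m e A R (d : arrow G) a b : urep I m e A R ->
  (a <= m)%N -> (b <= m)%N -> e a != tgt d -> R (arr d) a b = 0.
Proof.
move=> h la lb ne.
have -> : arr d = path_elt K (pvertex (tgt d)) * arr d.
  by rewrite path_eltM pcomp_vl eqxx.
rewrite (urepM h) // big_nat_cond big1 // => k; rewrite andbT => /andP[_ lk].
apply: etrans (congr1 (fun y => y * _) (urep_vertex h _ la lk)) _.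
by rewrite (negPf ne) andbF mul0r.
Qed.

(** Row m of [deform_relation] is contradictory. The coordinates z_b vanish for 0 < b < m, column 0
    vanishes by the choice of [mast_sum], and at b = m neither [d] nor [mast_sum] has a diagonal
    entry; yet the right side is t. *)
Lemma no_bypass_top m e A R (d : arrow G) : urep I m e A R -> (0 < m)%N ->
  src d = e 0%N -> tgt d = e m -> d != A 0%N ->
  (forall k, (0 < k < m)%N -> e k != e 0%N) -> False.
Proof.
move=> h m0 ds dt dA ne.
have [z [t [t0 ze zt]]] := deform_relation infK admI piI finL h m0 ds dt dA.
have := zt m (leqnn m); rewrite eqxx mulr1 big_nat_cond big1 => [/esym/eqP|b].
  by rewrite (negPf t0).
rewrite andbT => /andP[_ lb]; have [->|zb] := eqVneq (z b) 0; first by rewrite mulr0.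
have [b0|b0] := posnP b.
  rewrite b0 (mast_sumE _ _ _ _ h).
  rewrite (eq_big_nat _ _ (F2 := fun k => (k == m)%:R * R (arr d) k 0%N)).
    by rewrite sum_nat_delta // subrr mul0r.
  by move=> k /andP[_ lk]; rewrite (mast_prefix_top h) // mulrC eq_sym.
have -> : b = m.
  apply/eqP; move: lb; rewrite ltnS leq_eqVlt => /orP[//|lb].
  by have := ne b; rewrite b0 lb (ze b (ltnW lb) zb) eqxx => /(_ isT).
rewrite (urep_arrow_diag h) // (mast_sumE _ _ _ _ h) big_nat_cond big1 ?subrr ?mul0r //.
move=> k; rewrite andbT => /andP[_ lk].
case: k lk => [|k] lk; first by rewrite (urep_arrow_diag h) ?mul0r.
by rewrite (urep_diag h) // mast_prefix_vertex ?mulr0.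
Qed.

Lemma no_bypass M e A R i j (d : arrow G) : urep I M e A R -> (i < j <= M)%N ->
  src d = e i -> tgt d = e j -> d != A i ->
  (forall k, (i < k < j)%N -> e k != e i) -> False.
Proof.
move=> h /andP[ij jM] ds dt dA ne.
have h' := urep_segment (i := i) (m := j - i) h.
have ij' : (i + (j - i) = j)%N by rewrite subnKC // ltnW.
apply: (no_bypass_top (d := d) (h' _)); rewrite ?ij' ?addn0 ?subn_gt0 //.
by move=> k /andP[k0 kj]; apply: ne; lia.
Qed.

(** [no_bypass_top] does not apply: [e 0] recurs in layer 1, so z_1 may be nonzero. But [A 1],
    deformed here as an arrow from layer 0 to layer 3, is also the mast arrow from layer 1 to layer
    2. This gives z_1 the coefficient 1 in row 2 and forces z_1 = 0; row 3 then contradicts t <>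
    0. *)
Lemma no_double_loop_top e A R : urep I 3 e A R ->
  e 0%N = e 1%N -> e 2%N = e 3%N -> e 0%N != e 2%N -> False.
Proof.
move=> h e01 e23 e02.
have ds : src (A 1%N) = e 0%N by rewrite (urep_src h).
have dt : tgt (A 1%N) = e 3%N by rewrite (urep_tgt h).
have dA : A 1%N != A 0%N.
  apply/eqP => /(congr1 (@tgt G)); rewrite dt (urep_tgt h) // -e23 -e01 => E.
  by rewrite E eqxx in e02.
have [z [t [t0 ze zt]]] := deform_relation infK admI piI finL h isT ds dt dA.
have z2 : z 2%N = 0.
  by apply/eqP/negP => /negP/ze => /(_ isT) E; rewrite E eqxx in e02.
have z3 : z 3%N = 0.
  by apply/eqP/negP => /negP/ze => /(_ isT) E; rewrite e23 E eqxx in e02.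
have col0 a : (a <= 3)%N ->
    R (arr (A 1%N)) a 0%N - R (mast_sum 3 A R (A 1%N)) a 0%N = 0.
  move=> la; rewrite (mast_sumE _ _ _ _ h).
  rewrite (eq_big_nat _ _ (F2 := fun k => (k == a)%:R * R (arr (A 1%N)) k 0%N)).
    by rewrite sum_nat_delta // subrr.
  by move=> k /andP[_ lk]; rewrite (mast_prefix_top h) // mulrC eq_sym.
have zt' a : (a <= 3)%N ->
    (R (arr (A 1%N)) a 1%N - R (mast_sum 3 A R (A 1%N)) a 1%N) * z 1%N =
    t * (a == 3)%:R.
  move=> la; rewrite -(zt a la) !big_nat_recr //= big_geq // col0 // z2 z3.
  by rewrite !mulr0 !addr0 mul0r !add0r.
have z1 : z 1%N = 0.
  have := zt' 2%N isT; rewrite mulr0 (urep_mast h) // eqxx (mast_sumE _ _ _ _ h).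
  rewrite !big_nat_recr //= big_geq // (urep_arrow_diag h) // mul0r !add0r.
  rewrite (urep_arrow_eq0 (a := 1) h) ?dt -?e23 -?e01 // mul0r add0r.
  rewrite (mast_prefix_low (k := 2) h) // (mast_prefix_low (k := 3) h) //.
  by rewrite !mulr0 addr0 subr0 mul1r.
have := zt' 3%N isT; rewrite z1 mulr0 mulr1 => /esym/eqP.
by rewrite (negPf t0).
Qed.

Lemma no_double_loop M e A R i : urep I M e A R -> (i + 3 <= M)%N ->
  e i = e i.+1 -> e i.+2 = e i.+3 -> e i != e i.+2 -> False.
Proof.
move=> h iM e1 e2 e3.
apply: (no_double_loop_top (urep_segment (i := i) (m := 3) h iM));
  by rewrite ?addn0 ?addn1 ?addn2 ?addn3.
Qed.

End Obstructions.

(** * Vertex patterns of masts of length at most 4 *)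

Section Classification.
Local Open Scope nat_scope.

(* The constructors describe the three layered graphs of the theorem, [d] being  *)
(* the label of an additional edge leaving layer [k].                            *)
Inductive mast_shape (V E : eqType) (l : nat) (e : nat -> V) (A : nat -> E)
    (d : E) (k : nat) : Prop :=
| ShapeA of (3 <= l)%N & e 1%N = e 0%N & e 2%N = e 0%N & e 3%N != e 0%N &
    (l = 4 -> e 4%N != e 0%N /\ e 4%N != e 3%N) & k = 1%N & d = A 2%N
| ShapeB of l = 4 & e 1%N = e 0%N & e 2%N = e 0%N & e 3%N = e 0%N & e 4%N != e 0%N &
    (k = 1%N \/ k = 2%N) & d = A 3%N
| ShapeC of l = 4 & e 1%N != e 0%N & e 2%N = e 0%N & e 3%N = e 1%N &
    e 4%N != e 0%N & e 4%N != e 1%N & A 2%N = A 0%N & k = 1%N & d = A 3%N.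

(** A finite case analysis on vertices and arrows alone: [d] leaves layer k, q is a later layer at
    its target, and r is a layer where the top vertex recurs. *)
Lemma classification (V E : eqType) (s t : E -> V) (l : nat) (e : nat -> V)
    (A : nat -> E) (d : E) (k r q : nat) :
  (forall k, (k < l)%N -> s (A k) = e k) ->
  (forall k, (k < l)%N -> t (A k) = e k.+1) ->
  (forall i j d, (i < j <= l)%N -> s d = e i -> t d = e j ->
    d != A i -> (forall k, (i < k < j)%N -> e k != e i) -> False) ->
  (forall i, (i + 3 <= l)%N ->
    e i = e i.+1 -> e i.+2 = e i.+3 -> e i != e i.+2 -> False) ->
  (l <= 4)%N -> (0 < r)%N -> (r + k < l)%N ->
  e r = e 0%N -> (0 < k)%N -> s d = e k -> d != A k -> (k < q <= l)%N ->
  t d = e q -> mast_shape l e A d k.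
Proof.
move=> A_src A_tgt bypass double_loop l4 r0 rk er k0 ds dA /andP[kq ql] dt.
(* No layer lies strictly between i and i + 1, so the condition on recurrence is empty. *)
have arrow_unique i d' : (i < l)%N -> s d' = e i -> t d' = e i.+1 -> d' = A i.
  move=> il ds' dt'; apply/eqP/negP => /negP ne.
  by apply: (@bypass i i.+1 d') => // [|i']; lia.
have q2 : q != k.+1.
  by apply/eqP => H; move: dA; rewrite (arrow_unique k d) ?eqxx -?H //; lia.
have ne_next : t d != e k.+1.
  by apply: contraNneq dA => H; apply/eqP; apply: arrow_unique => //; lia.
have A_ne i j : (i < l)%N -> (j < l)%N -> e i.+1 != e j.+1 -> A i != A j.
  by move=> il jl; apply: contraNneq => H; rewrite -!A_tgt ?H.
(* Since k > 0 and r + k < l <= 4, r is 1 or 2. If [e 1 != e 0], then r = 2, and this leads to graph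
   C. *)
have [e10|e10] := eqVneq (e 1%N) (e 0%N); last first.
  have r2 : r = 2.
    case: r r0 rk er => [|[|[|r]]] // _ rk er; last by lia.
    by rewrite er eqxx in e10.
  subst r; have kE : k = 1%N by lia.
  have lE : l = 4 by lia.
  subst k l; rewrite er in ne_next.
  have td3 : t d != e 3%N.
    apply/eqP => H; apply: (@bypass 1 3 d) => // i; case: i => [|[|[|]]] // _.
    by rewrite er eq_sym.
  have q4 : q = 4.
    case: q kq ql dt q2 {dA} => [|[|[|[|[|]]]]] // _ _ H.
    by rewrite H eqxx in td3.
  subst q; have e31 : e 3%N = e 1%N.
    apply/eqP/negP => /negP e31.
    apply: (@bypass 1 4 d) => // i; case: i => [|[|[|[|]]]] // _.
    by rewrite er eq_sym.
  apply: ShapeC => //.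
  - by rewrite -dt.
  - by rewrite -dt -e31.
  - by apply: esym; apply: arrow_unique; rewrite ?A_src ?A_tgt ?er ?e31.
  - by apply: arrow_unique; rewrite ?e31.
have [l3|k2] := leqP k 1.
  have kE : k = 1%N by lia.
  subst k; have l3' : (2 < l)%N by lia.
  have td4 : t d != e 3%N -> l = 4 /\ t d = e 4%N.
    move=> H; have qn3 : q != 3 by apply/eqP => qE; rewrite dt qE eqxx in H.
    have q4 : q = 4 by lia.
    by rewrite -q4 dt; split=> //; lia.
  have [e20|e20] := eqVneq (e 2%N) (e 0%N).
    have [td3|td3] := eqVneq (t d) (e 3%N).
      have e30 : e 3%N != e 0%N by rewrite -td3 -e20.
      apply: ShapeA => //; last by apply: arrow_unique; rewrite ?ds ?e10.
      move=> lE; subst l; split.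
        (* If [e 4] were the top vertex, the loop [A 0] would bypass layer 3. *)
        apply/eqP => e40; apply: (@bypass 2 4 (A 0%N)) => //.
        - by rewrite A_src.
        - by rewrite A_tgt // e10.
        - by apply: A_ne; rewrite // e10 eq_sym.
        - by case=> [|[|[|[|]]]] // _; rewrite e20.
      by apply/eqP => e43; apply: (@double_loop 1) => //; rewrite ?e10 // eq_sym.
    have [lE td4'] := td4 td3; subst l.
    have [e30|e30] := eqVneq (e 3%N) (e 0%N).
      apply: ShapeB => //; first by rewrite -td4' -e20.
        by left.
      by apply: arrow_unique; rewrite ?ds ?e30.
    (* As [e 1 = e 2], the arrow [d] leaves layer 2 as well. *)
    exfalso; apply: (@bypass 2 4 d) => //.
    - by rewrite ds e10.
    - by apply: contraNneq td3 => ->; rewrite A_tgt.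
    - by case=> [|[|[|[|]]]] // _; rewrite e20.
  (* Now [e 2] is not the top vertex. Then [e 3 = e 2] gives the pattern a, a, b, b, and otherwise
     [d] or the loop [A 0] is a bypass out of layer 1. *)
  exfalso; have [e32|e32] := eqVneq (e 3%N) (e 2%N).
    by apply: (@double_loop 0) => //; rewrite eq_sym.
  have e21 : forall k, (1 < k < 3)%N -> e k != e 1%N.
    by case=> [|[|[|]]] // _; rewrite e10.
  have [td3|td3] := eqVneq (t d) (e 3%N); first by apply: (@bypass 1 3 d).
  have [e30|e30] := eqVneq (e 3%N) (e 0%N).
    apply: (@bypass 1 3 (A 0%N)) => //.
    - by rewrite A_src //; lia.
    - by rewrite A_tgt ?e10 //; lia.
    - by apply: A_ne; rewrite ?e10 1?eq_sym //; lia.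
  have [lE td4'] := td4 td3; subst l.
  apply: (@bypass 1 4 d) => //.
  by case=> [|[|[|[|]]]] // _; rewrite e10.
have kE : k = 2 by lia.
have lE : l = 4 by lia.
subst k l; have q4 : q = 4 by lia.
subst q; have e32 : e 3%N = e 2%N.
  apply/eqP/negP => /negP e32; apply: (@bypass 2 4 d) => //.
  by case=> [|[|[|[|]]]].
have e20 : e 2%N = e 0%N.
  apply/eqP/negP => /negP e20; apply: (@double_loop 0) => //.
  by rewrite eq_sym.
apply: ShapeB => //; rewrite ?e32 //.
- by rewrite -dt -e20 -e32.
- by right.
- by apply: arrow_unique; rewrite ?e32.
Qed.

End Classification.

(** * Radical layers of a uniserial module *)

Section Scalars.
Context (K : fieldType) (G : quiver) (L : pzRingType).
Context (pi : {rmorphism pathalg K G -> L}) (U : lmodType L).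
Local Notation KG := (pathalg K G).
Local Notation vert e := (path_elt K (pvertex e)).

Fact kscale_key : unit. Proof. exact: tt. Qed.
(** U is only an L-module, and K acts on it through the multiples of the unit of the path algebra.
    Locking keeps the definition from unfolding. *)
Definition kscale : K -> U -> U :=
  locked_with kscale_key (fun c z => pi (c *: (1 : KG)) *: z).

Lemma kscaleE1 c z : kscale c z = pi (c *: (1 : KG)) *: z.
Proof. by rewrite /kscale unlock. Qed.

Lemma scale_one_mull c (f : KG) : c *: f = (c *: (1 : KG)) * f.
Proof.
by apply: esym; apply: etrans (esym (pathalg_scalerAl _ _ _)) _; rewrite mul1r.
Qed.

Lemma scale_one_mulr c (f : KG) : c *: f = f * (c *: (1 : KG)).
Proof.
by apply: esym; apply: etrans (esym (pathalg_scalerAr _ _ _)) _; rewrite mulr1.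
Qed.

Lemma kscaleE c (f : KG) z : pi (c *: f) *: z = kscale c (pi f *: z).
Proof.
apply: etrans (congr1 (fun g : KG => pi g *: z) (scale_one_mull c f)) _.
by rewrite rmorphM -scalerA kscaleE1.
Qed.

Lemma kscale_pi c (f : KG) z : pi f *: kscale c z = kscale c (pi f *: z).
Proof.
rewrite -kscaleE; apply: esym.
apply: etrans (congr1 (fun g : KG => pi g *: z) (scale_one_mulr c f)) _.
by rewrite rmorphM -scalerA -kscaleE1.
Qed.

Lemma kscaleDl c d z : kscale (c + d) z = kscale c z + kscale d z.
Proof.
rewrite !kscaleE1.
apply: etrans (congr1 (fun g : KG => pi g *: z) (scalerDl (1 : KG) c d)) _.
by rewrite rmorphD scalerDl.
Qed.

Lemma kscaleDr c z w : kscale c (z + w) = kscale c z + kscale c w.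
Proof. by rewrite !kscaleE1 scalerDr. Qed.

Lemma kscaleA c d z : kscale c (kscale d z) = kscale (c * d) z.
Proof.
rewrite [kscale d z]kscaleE1 -kscaleE kscaleE1.
exact: (congr1 (fun g : KG => pi g *: z) (scalerA c d (1 : KG))).
Qed.

Lemma kscale1 z : kscale 1 z = z.
Proof. by rewrite kscaleE1 scale1r rmorph1 scale1r. Qed.

Lemma kscale0 z : kscale 0 z = 0.
Proof. by rewrite kscaleE1 scale0r rmorph0 scale0r. Qed.

Lemma kscaler0 c : kscale c 0 = 0.
Proof. by rewrite kscaleE1 scaler0. Qed.

Lemma kscale_sumr c n (F : nat -> U) :
  kscale c (\sum_(0 <= j < n) F j) = \sum_(0 <= j < n) kscale c (F j).
Proof. exact: (big_morph _ (kscaleDr c) (kscaler0 c)). Qed.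

Lemma vertex_act (u : vertex G) (w : U) (f : KG) :
  (forall v, pi (vert v) *: w = if v == u then w else 0) ->
  pi f *: w = kscale (path_coeff f (pvertex u)) w + pi (f - vertex_part f) *: w.
Proof.
move=> hw; have <- : pi (vertex_part f) *: w = kscale (path_coeff f (pvertex u)) w.
  rewrite /vertex_part rmorph_sum scaler_suml.
  transitivity (\sum_v if v == u then kscale (path_coeff f (pvertex u)) w else 0).
    apply: eq_bigr => v _; apply: etrans (kscaleE _ _ _) _; rewrite hw.
    by case: eqP => [->|_] //; apply: kscaler0.
  by rewrite -big_mkcond big_pred1_eq.
by rewrite rmorphB scalerBl addrC subrK.
Qed.

Lemma submodule_kscale (S : U -> Prop) c z : submodule S -> S z -> S (kscale c z).
Proof. by case=> _ _ SZ Sz; rewrite kscaleE1; apply: SZ. Qed.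

Lemma submodule_kscaleV (S : U -> Prop) c z :
  submodule S -> c != 0 -> S (kscale c z) -> S z.
Proof.
move=> subS c0 Sz; rewrite -[z]kscale1 -(mulVf c0) -kscaleA.
exact: submodule_kscale.
Qed.

Lemma submoduleN (S : U -> Prop) z : submodule S -> S z -> S (- z).
Proof. by case=> _ _ SZ Sz; rewrite -scaleN1r; apply: SZ. Qed.

End Scalars.

(** * The Jacobson radical and the arrow ideal *)

Section Jacobson.
Context (K : fieldType) (G : quiver) (I : pathalg K G -> Prop) (L : pzRingType).
Context (pi : {rmorphism pathalg K G -> L}).
Hypotheses (admI : admissible I) (piI : quotient_map I pi).
Local Notation KG := (pathalg K G).

Lemma jacobsonMl (r s : L) : jacobson r -> jacobson (s * r).
Proof. by move=> jr S Smax; case: (Smax) => -[_ _ SZ] _ _; apply: SZ; apply: jr. Qed.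

(** If a maximal left ideal S missed [pi f], adding the image of the arrow ideal to S would give all
    of L, so S would contain [1 - pi g] for some g in the arrow ideal. Then S contains all
    [1 - pi g ^+ k], and g is nilpotent modulo [I]. *)
Lemma jacobson_arrow_ideal (f : KG) : arrow_ideal_pow 1 f -> jacobson (pi f).
Proof.
move=> hf S [subS [x0 nx0] Smax]; apply: NNPP => nSf.
case: (subS) => S0 SD SZ.
pose S' (r : L^o) := exists y g, [/\ S y, arrow_ideal_pow 1 g & r = y + pi g].
have subS' : submodule S'.
  split.
  - exists 0, 0; split=> //; first by move=> p; rewrite path_coeff0 eqxx.
    by rewrite rmorph0 addr0.
  - move=> _ _ [y [g [Sy hg ->]]] [y' [g' [Sy' hg' ->]]].
    exists (y + y'), (g + g'); split; [exact: SD|exact: arrow_ideal_pow_add|].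
    by rewrite rmorphD addrACA.
  - move=> r _ [y [g [Sy hg ->]]]; have [h <-] := piI.1 r.
    exists (pi h *: y), (h * g); split; first exact: SZ.
      by apply: (@arrow_ideal_powM _ _ 0 1).
    by rewrite scalerDr rmorphM.
have SS' : included S S'.
  move=> y Sy; exists y, 0; split=> //; first by move=> p; rewrite path_coeff0 eqxx.
  by rewrite rmorph0 addr0.
case: (Smax S' subS' SS') => [S'S|/(_ (1 : L))].
  apply: nSf; apply: S'S; exists 0, f; split=> //.
  by rewrite add0r.
case=> y [g [Sy hg e1]].
have ey : y = 1 - pi g :> L by rewrite e1 addrK.
have SX k : S (1 - pi g ^+ k : L).
  elim: k => [|k IH]; first by rewrite expr0 subrr.
  have -> : 1 - pi g ^+ k.+1 = y + pi g * (1 - pi g ^+ k) :> L.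
    by rewrite ey mulrBr mulr1 exprS addrA subrK.
  by apply: SD => //; apply: (SZ (pi g)).
have [_ _ [N _ hN]] := admI.
apply: nx0; have S1 : S (1 : L).
  have := SX N; rewrite -rmorphXn /=.
  have -> : pi (g ^+ N) = 0 by apply/(piI.2)/hN/arrow_ideal_powX.
  by rewrite subr0.
by have := SZ x0 _ S1; rewrite /GRing.scale /= mulr1.
Qed.

(** T/S is simple. If z is not in S, the annihilator of z modulo S is a maximal left ideal and so
    contains r. *)
Lemma jacobson_layer (U : lmodType L) (S T : U -> Prop) r z :
  submodule S -> submodule T ->
  (forall S' : U -> Prop, submodule S' -> included S S' -> included S' T ->
     included S' S \/ included T S') ->
  included S T -> jacobson r -> T z -> S (r *: z).
Proof.
move=> subS subT ST_simple ST jr Tz; have [Sz|nSz] := classic (S z).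
  by case: subS => _ _; apply.
case: (subS) => S0 SD SZ; case: (subT) => T0 TD TZ.
suff max : maximal_submodule (fun s : L^o => S ((s : L) *: z)) by apply: (jr _ max).
split.
- split; first by rewrite scale0r.
    by move=> s t Ss St; rewrite scalerDl; apply: SD.
  by move=> s t St; rewrite -[(s *: t : L)]/((s : L) * t) -scalerA; apply: SZ.
- by exists (1 : L); rewrite scale1r.
move=> Q [Q0 QD QZ] SQ.
pose S' w := exists s y, [/\ Q s, S y & w = (s : L) *: z + y].
have subS' : submodule S'.
  split.
  - by exists 0, 0; rewrite scale0r addr0.
  - move=> _ _ [s [y [Qs Sy ->]]] [s' [y' [Qs' Sy' ->]]].
    exists (s + s'), (y + y'); split; [exact: QD|exact: SD|].
    by rewrite scalerDl addrACA.
  - move=> t _ [s [y [Qs Sy ->]]]; exists (t * s), (t *: y).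
    by split; [apply: (QZ t)|apply: SZ|rewrite scalerDr scalerA].
have SS' : included S S' by move=> y Sy; exists 0, y; rewrite scale0r add0r.
have S'T : included S' T.
  by move=> _ [s [y [_ Sy ->]]]; apply: TD; [apply: TZ|apply: ST].
case: (ST_simple S' subS' SS' S'T) => [S'S|TS'].
  by left=> s Qs; apply: S'S; exists s, 0; rewrite addr0.
right=> t; have [s [y [Qs Sy ez]]] := TS' z Tz.
have Q1 : Q (1 : L).
  have -> : 1 = s + (1 - s) :> L by rewrite addrC subrK.
  apply: QD => //; apply: SQ; rewrite scalerBl scale1r {1}ez.
  by rewrite addrAC subrr add0r.
by have := QZ t _ Q1; rewrite /GRing.scale /= mulr1.
Qed.

End Jacobson.

Section PathPrefix.
Context (G : quiver) (p : qpath G) (a0 : arrow G).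

Definition pnode (k : nat) : vertex G := nth (pstart p) (pnodes p) k.
Definition pstep (k : nat) : arrow G := nth a0 (parrows p) k.

Lemma last_take (T : Type) (v : T) s k : (k <= size s)%N ->
  last v (take k s) = nth v (v :: s) k.
Proof.
elim: s v k => [|b s IH] v [|k] //= lk; rewrite IH //.
by case: k lk => //= k lk; apply: set_nth_default; lia.
Qed.

Lemma pend_ptake k : (k <= plen p)%N -> pend (ptake k p) = pnode k.
Proof.
by move=> lk; rewrite /pend /walk_end /= map_take last_take // size_map.
Qed.

Lemma plen_ptake k : (k <= plen p)%N -> plen (ptake k p) = k.
Proof. exact: size_takel. Qed.

Lemma ptake_plen : ptake (plen p) p = p.
Proof. by apply: val_inj => /=; rewrite take_size -surjective_pairing. Qed.

Lemma pstep_tgt k : (k < plen p)%N -> tgt (pstep k) = pnode k.+1.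
Proof.
move=> lk; rewrite /pstep /pnode /pnodes /= (nth_map a0) //.
Qed.

Lemma pstep_src k : (k < plen p)%N -> src (pstep k) = pnode k.
Proof.
have gen s v : is_walk v s -> (k < size s)%N ->
    src (nth a0 s k) = nth v (v :: map (@tgt G) s) k.
  elim: k s v => [|k IH] [|a s] v //= /andP[/eqP // av ws] lk.
  rewrite (IH _ _ ws lk) /=; apply: set_nth_default; rewrite /= size_map; lia.
exact: gen (pvalP p).
Qed.

Lemma pcomp_pstep k : (k < plen p)%N ->
  pcomp (parrow (pstep k)) (ptake k p) = Some (ptake k.+1 p).
Proof.
move=> lk; apply/eqP; rewrite pcompE pend_ptake 1?ltnW //.
rewrite -[pstart (parrow _)]/(src (pstep k)) pstep_src // eqxx.
rewrite -[pstart (ptake _ _)]/(pstart p) -[pstart (ptake k _)]/(pstart p) eqxx.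
rewrite -[parrows (ptake k.+1 p)]/(take k.+1 (parrows p)) (take_nth a0) //.
by rewrite -[parrows (parrow _)]/[:: pstep k] cats1 !eqxx.
Qed.

Context (K : fieldType) (L : pzRingType) (pi : {rmorphism pathalg K G -> L}).
Context (U : lmodType L).

Lemma pi_scaleM (f g : pathalg K G) (z : U) : pi f *: (pi g *: z) = pi (f * g) *: z.
Proof. by rewrite [in RHS]rmorphM scalerA. Qed.

Definition mast_elt (x : U) (k : nat) : U := pi (path_elt K (ptake k p)) *: x.

Lemma mast_eltS x k : (k < plen p)%N ->
  mast_elt x k.+1 = pi (path_elt K (parrow (pstep k))) *: mast_elt x k.
Proof.
move=> lk; apply: esym; apply: etrans (pi_scaleM _ _ _) _.
by apply: (congr1 (fun f => pi f *: x)); rewrite path_eltM pcomp_pstep.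
Qed.

Lemma vertex_mast_elt x v k : (k <= plen p)%N ->
  pi (path_elt K (pvertex v)) *: mast_elt x k =
  if v == pnode k then mast_elt x k else 0.
Proof.
move=> lk; apply: etrans (pi_scaleM _ _ _) _.
rewrite path_eltM pcomp_vl pend_ptake //.
by case: eqP => // _; rewrite rmorph0 scale0r.
Qed.

Lemma mast_elt_plen x : mast_elt x (plen p) = pi (path_elt K p) *: x.
Proof. by rewrite /mast_elt ptake_plen. Qed.

Lemma ptake0 : ptake 0 p = pvertex (pstart p).
Proof. by apply: val_inj; rewrite /= take0. Qed.

Context (I : pathalg K G -> Prop) (admI : admissible I) (piI : quotient_map I pi).

(* [V k] is the k-th radical layer J^k U. *)
Record layers (x : U) (V : nat -> U -> Prop) : Prop := Layers {
  layer_sub : forall k, submodule (V k);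
  layer_all : forall z, V 0%N z;
  layer_dec : forall k, included (V k.+1) (V k);
  layer_end : forall k z, (plen p < k)%N -> V k z -> z = 0;
  layer_jac : forall k r z, jacobson r -> V k z -> V k.+1 (r *: z);
  layer_elt : forall k, (k <= plen p)%N -> V k (mast_elt x k);
  layer_eltN : forall k, (k <= plen p)%N -> ~ V k.+1 (mast_elt x k);
  layer_span : forall k z, (k <= plen p)%N -> V k z ->
    exists c, V k.+1 (z - kscale pi c (mast_elt x k)) }.

Lemma jacobson_parrow a : jacobson (pi (path_elt K (parrow a))).
Proof. by apply: (jacobson_arrow_ideal admI piI); apply: arrow_ideal_pow_elt. Qed.

Lemma mast_elt_residue (V : nat -> U -> Prop) x (f : pathalg K G) k :
  (forall k, submodule (V k)) ->
  (forall k r z, jacobson r -> V k z -> V k.+1 (r *: z)) ->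
  (k <= plen p)%N -> V k (mast_elt x k) ->
  V k.+1 (pi f *: mast_elt x k -
    kscale pi (path_coeff f (pvertex (pnode k))) (mast_elt x k)).
Proof.
move=> subV jacV lk Vk.
rewrite (@vertex_act _ _ _ pi U (pnode k) (mast_elt x k)); last first.
  by move=> v; apply: vertex_mast_elt.
rewrite addrC addKr; apply: jacV => //.
by apply: (jacobson_arrow_ideal admI piI); apply: arrow_part.
Qed.

(** The layers are the composition series counted from the top. The mast hypothesis only gives some
    y with p y <> 0, whereas x is an arbitrary top element; so y is treated first and then compared
    with x. *)
Lemma layers_exist x : (0 < plen p)%N -> is_mast pi U p -> top_element pi x ->
  pi (path_elt K (pvertex (pstart p))) *: x = x /\ exists V, layers x V.
Proof.
move=> l0 [[_ Uchain] [M [Msub M0 Mall Mstep]] [y py]] [xtop [e' xe']].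
set l := plen p in l0 Msub Mall Mstep *.
(* Truncated subtraction makes [V k] zero for all k > l. *)
pose V k := M (l.+1 - k)%N.
have subV k : submodule (V k) by apply: Msub; rewrite leq_subr.
have decV k : included (V k.+1) (V k).
  move=> z; rewrite /V; have [lk|lk] := leqP k l; last first.
    by have -> : (l.+1 - k.+1 = l.+1 - k)%N by lia.
  rewrite subSS (subSn lk) => Vz; have [le _ _] := Mstep (l - k)%N (leq_subr _ _).
  exact: le.
have endV k z : (l < k)%N -> V k z -> z = 0.
  by move=> lk; rewrite /V (_ : l.+1 - k = 0)%N; [move/M0|lia].
have jacV k r z : jacobson r -> V k z -> V k.+1 (r *: z).
  move=> jr Vz; have [lk|lk] := leqP k l; last first.
    by rewrite (endV k z) // scaler0; case: (subV k.+1).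
  have [le _ sim] := Mstep (l - k)%N (leq_subr _ _).
  move: Vz (subV k.+1) (subV k); rewrite /V subSS (subSn lk) => Vz s1 s2.
  exact: (jacobson_layer s1 s2 sim).
have simV k (S : U -> Prop) : (k <= l)%N -> submodule S -> included (V k.+1) S ->
    included S (V k) -> included S (V k.+1) \/ included (V k) S.
  move=> lk; have [_ _ sim] := Mstep (l - k)%N (leq_subr _ _).
  by move: sim; rewrite /V subSS (subSn lk); apply.
pose y0 := pi (path_elt K (pvertex (pstart p))) *: y.
have eltV w k : (k <= l)%N -> V 0%N w -> V k (mast_elt w k).
  move=> lk Vw; elim: k lk => [_|k IH lk].
    by case: (subV 0%N) => _ _; apply.
  by rewrite mast_eltS //; apply: jacV; [apply: jacobson_parrow|apply: IH; lia].
(* An element lying one layer too deep is pushed beyond the last layer by the rest of the mast. *)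
have eltVN w k : (k <= l)%N -> V 0%N w -> V k.+1 (mast_elt w k) -> mast_elt w l = 0.
  move=> lk Vw Vk; have step j : (k + j <= l)%N -> V (k + j).+1 (mast_elt w (k + j)).
    elim: j => [|j IH] lj; first by rewrite addn0.
    rewrite addnS mast_eltS; last by lia.
    by apply: jacV; [apply: jacobson_parrow|apply: IH; lia].
  apply: (endV l.+1); first by [].
  by have := step (l - k)%N; rewrite (subnKC lk) => H; apply: (H (leqnn l)).
have V0 w : V 0%N w by rewrite /V subn0; apply: Mall.
have y0l : mast_elt y0 l != 0.
  rewrite mast_elt_plen pi_scaleM path_eltM pcomp_vr eqxx.
  exact: py.
have y0E : mast_elt y0 0 = y0.
  by rewrite /mast_elt ptake0 /y0 pi_scaleM path_eltM pcomp_vl eqxx.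
have spanV w k z : (k <= l)%N -> mast_elt w l != 0 -> V k z ->
    exists c, V k.+1 (z - kscale pi c (mast_elt w k)).
  move=> lk wl Vz; case: (subV k.+1) => S0 SD SZ; case: (subV k) => T0 TD TZ.
  pose S t := exists r s, V k.+1 s /\ t = r *: mast_elt w k + s.
  have [|||SV|VS] := simV k S lk.
  - split; first by exists 0, 0; rewrite scale0r addr0.
      move=> _ _ [r [s [Vs ->]]] [r' [s' [Vs' ->]]]; exists (r + r'), (s + s').
      by split; [apply: SD|rewrite scalerDl addrACA].
    move=> r _ [r' [s [Vs ->]]]; exists (r * r'), (r *: s).
    by split; [apply: SZ|rewrite scalerDr scalerA].
  - by move=> s Vs; exists 0, s; rewrite scale0r add0r.
  - move=> _ [r [s [Vs ->]]]; apply: TD; last exact: decV.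
    by apply: TZ; apply: eltV.
  - exfalso; move/eqP: wl; apply; apply: (eltVN w k) => //; apply: SV.
    by exists 1, 0; rewrite scale1r addr0.
  have [r [s [Vs ->]]] := VS z Vz; have [f <-] := piI.1 r.
  exists (path_coeff f (pvertex (pnode k))); rewrite addrAC; apply: SD => //.
  by apply: mast_elt_residue => //; apply: eltV.
(* [V 1] is generated by the mast element in layer 1, so it lies in JU and contains no top
   element. *)
have V1_Jpow z : V 1%N z -> Jpow 1 z.
  move=> V1z; pose S t := exists r, t = r *: mast_elt y0 1.
  have subS : submodule S.
    split; first by exists 0; rewrite scale0r.
      by move=> _ _ [r ->] [r' ->]; exists (r + r'); rewrite scalerDl.
    by move=> r _ [r' ->]; exists (r * r'); rewrite scalerA.
  have [c Vc] := spanV y0 1%N z l0 y0l V1z.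
  have [r zr] : S z.
    rewrite -(subrK (kscale pi c (mast_elt y0 1)) z); case: (subS) => _ SD _.
    apply: SD; last by apply: submodule_kscale => //; exists 1; rewrite scale1r.
    case: (Uchain S (V 2%N) subS (subV 2%N)) => [SV|]; last by apply.
    exfalso; move/eqP: y0l; apply; apply: (eltVN y0 1%N) => //; apply: SV.
    by exists 1; rewrite scale1r.
  exists 1%N, (fun=> r * pi (path_elt K (parrow (pstep 0)))), (fun=> mast_elt y0 0).
  split=> [_|].
    by split=> //; apply: jacobsonMl; apply: jacobson_parrow.
  by rewrite big_ord1 -scalerA -mast_eltS.
(* Modulo [V 1], x is a multiple of [y0], with nonzero factor because x is a top element. *)
have [c Vc] := spanV y0 0%N x (leq0n _) y0l (V0 x); rewrite y0E in Vc.
have c0 : c != 0.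
  apply/eqP => c0; apply: xtop; apply: V1_Jpow.
  by move: Vc; rewrite c0 kscale0 subr0.
have e'E : e' = pstart p.
  apply/eqP/negP => /negP ne; move/eqP: y0l; apply; apply: (eltVN y0 0%N) => //.
  rewrite y0E; apply: (submodule_kscaleV (pi := pi) (subV 1%N) c0).
  have : V 1%N (pi (path_elt K (pvertex (pstart p))) *: (x - kscale pi c y0)).
    by case: (subV 1%N) => _ _; apply.
  have -> : pi (path_elt K (pvertex (pstart p))) *: (x - kscale pi c y0) =
            - kscale pi c y0.
    rewrite scalerBr kscale_pi {1}xe' pi_scaleM path_eltM pcomp_vl.
    rewrite eq_sym (negPf ne) rmorph0 scale0r sub0r; congr (- kscale pi c _).
    by rewrite -[in LHS]y0E vertex_mast_elt // eqxx y0E.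
  by move/(submoduleN (subV 1%N)); rewrite opprK.
have xE : pi (path_elt K (pvertex (pstart p))) *: x = x by rewrite -e'E -xe'.
have xl : mast_elt x l != 0.
  apply/eqP => xl; move/eqP: y0l; apply.
  have V1l : V l.+1 (mast_elt (x - kscale pi c y0) l).
    have step k : (k <= l)%N -> V k.+1 (mast_elt (x - kscale pi c y0) k).
      elim: k => [_|k IH lk]; first by case: (subV 1%N) => _ _; apply.
      by rewrite mast_eltS //; apply: jacV; [apply: jacobson_parrow|apply: IH; lia].
    exact: step.
  apply: (endV l.+1) => //; apply: (submodule_kscaleV (pi := pi) (subV l.+1) c0).
  rewrite -[kscale _ _ _]opprK -[- kscale _ _ _]add0r -xl.
  apply: submoduleN => //; move: V1l.
  by rewrite /mast_elt scalerBr kscale_pi.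
split=> //; exists V; split=> //.
- by move=> k lk; apply: eltV.
- by move=> k lk Vk; move/eqP: xl; apply; apply: (eltVN x k).
- by move=> k z lk Vz; apply: spanV.
Qed.

End PathPrefix.

(** * Coordinates along the mast *)

Section Coordinates.
Context (K : fieldType) (G : quiver) (I : pathalg K G -> Prop) (L : pzRingType).
Context (pi : {rmorphism pathalg K G -> L}).
Context (admI : admissible I) (piI : quotient_map I pi).
Context (p : qpath G) (a0 : arrow G) (U : lmodType L) (x : U).
Context (V : nat -> U -> Prop) (layV : layers p pi x V).
Local Notation KG := (pathalg K G).
Local Notation X := (mast_elt p pi x).
Local Notation l := (plen p).

Lemma submodule_sum (S : U -> Prop) (s : seq nat) (F : nat -> U) :
  submodule S -> (forall j, j \in s -> S (F j)) -> S (\sum_(j <- s) F j).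
Proof.
by move=> [S0 SD _] SF; rewrite big_seq; apply: big_ind.
Qed.

Lemma layer_le j k : (j <= k)%N -> included (V k) (V j).
Proof.
move=> jk; rewrite -(subnKC jk); elim: (k - j)%N => [|n IH] z.
  by rewrite addn0.
by rewrite addnS => /(layer_dec layV)/IH.
Qed.

Definition mast_comb (c : nat -> K) : U :=
  \sum_(0 <= j < l.+1) kscale pi (c j) (X j).

Lemma mast_combD c c' :
  mast_comb c + mast_comb c' = mast_comb (fun j => c j + c' j).
Proof. by rewrite /mast_comb -big_split; apply: eq_bigr => j _; rewrite kscaleDl. Qed.

Lemma mast_comb_scale d c : kscale pi d (mast_comb c) = mast_comb (fun j => d * c j).
Proof. by rewrite /mast_comb kscale_sumr; apply: eq_bigr => j _; rewrite kscaleA. Qed.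

Lemma mast_comb_elt b : (b <= l)%N -> mast_comb (fun j => (j == b)%:R) = X b.
Proof.
move=> lb; rewrite /mast_comb (bigD1_seq b) ?mem_index_iota ?iota_uniq //= eqxx.
by rewrite kscale1 big1 ?addr0 // => j /negPf ->; rewrite kscale0.
Qed.

Lemma mast_comb_ex k z : (k <= l.+1)%N -> V k z ->
  exists c, (forall j, (j < k)%N -> c j = 0) /\ z = mast_comb c.
Proof.
move=> lk; rewrite -(subKn lk); move: (leq_subr k l.+1).
elim: (l.+1 - k)%N z => {k lk} [|n IH] z ln Vz.
  exists (fun=> 0); split=> //; rewrite (layer_end layV _ Vz) ?subn0 //.
  by rewrite /mast_comb big1 // => j _; rewrite kscale0.
set k := (l.+1 - n.+1)%N in Vz *.
have kS : k.+1 = (l.+1 - n)%N by rewrite /k; lia.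
have [|c Vc] := layer_span layV _ Vz; first by rewrite /k; lia.
rewrite kS in Vc; have [c' [c'0 zc]] := IH _ (ltnW ln) Vc.
exists (fun j => c' j + c * (j == k)%:R); split=> [j jk|].
  by rewrite c'0 -?kS 1?ltnW // (ltn_eqF jk) mulr0 addr0.
rewrite -mast_combD -zc -mast_comb_scale mast_comb_elt ?subrK //.
by rewrite /k; lia.
Qed.

(** Otherwise the first nonzero coefficient, at [X j], would put [X j] into [V j.+1]. *)
Lemma mast_comb_eq0 c : mast_comb c = 0 -> forall j, (j <= l)%N -> c j = 0.
Proof.
move=> c0 j; elim/ltn_ind: j => j IH lj; apply/eqP/negP => /negP cj.
apply: (layer_eltN layV lj).
apply: (submodule_kscaleV (pi := pi) (layer_sub layV j.+1) cj).
have -> : kscale pi (c j) (X j) =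
    - \sum_(i <- index_iota 0 l.+1) if i != j then kscale pi (c i) (X i) else 0.
  apply/eqP; rewrite -addr_eq0 -big_mkcond /=; apply/eqP.
  by rewrite -[RHS]c0 /mast_comb [RHS](bigD1_seq j) ?mem_index_iota ?iota_uniq.
apply: submoduleN; first exact: layer_sub layV _.
apply: submodule_sum => [|i]; first exact: layer_sub layV _.
rewrite mem_index_iota => /andP[_ li].
have V0 : V j.+1 0 by case: (layer_sub layV j.+1).
have [-> //|ne] := eqVneq i j; have [ij|ji] := ltnP i j.
  by rewrite IH ?kscale0 //; lia.
have ij : (j < i)%N by rewrite ltn_neqAle eq_sym ne.
apply: (layer_le ij); apply: submodule_kscale.
  exact: layer_sub layV _.
exact: (layer_elt layV).
Qed.

Lemma mast_comb_inj c c' : mast_comb c = mast_comb c' ->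
  forall j, (j <= l)%N -> c j = c' j.
Proof.
move=> cc' j lj; apply/eqP; rewrite -subr_eq0; apply/eqP.
have -> : c j - c' j = c j + -1 * c' j by rewrite mulN1r.
apply: (@mast_comb_eq0 (fun j => c j + -1 * c' j)) lj.
rewrite -mast_combD -mast_comb_scale cc'.
by rewrite -{1}[mast_comb c'](kscale1 pi) -kscaleDl subrr kscale0.
Qed.

(** Row vectors, unlike functions on [nat], form a choice type, as [xchoose] requires. *)
Fact mast_coord_subproof (z : U) :
  exists v : 'rV[K]_l.+1, mast_comb (fun j => v 0 (inord j)) == z.
Proof.
have [c [_ zc]] := mast_comb_ex (leq0n _) (layer_all layV z).
exists (\row_j c j); apply/eqP; rewrite {}zc /mast_comb.
by apply: eq_big_nat => j /andP[_ lj]; rewrite mxE inordK.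
Qed.

Definition mast_coord (z : U) (j : nat) : K :=
  xchoose (mast_coord_subproof z) 0 (inord j).

Lemma mast_coordK z : mast_comb (mast_coord z) = z.
Proof. exact/eqP/(xchooseP (mast_coord_subproof z)). Qed.

Lemma mast_combK c j : (j <= l)%N -> mast_coord (mast_comb c) j = c j.
Proof. by apply: mast_comb_inj; rewrite mast_coordK. Qed.

(** Beyond l the coordinate is read at index 0, the default of [inord]; so linearity holds for every
    j. *)
Lemma mast_coord_inord z j : mast_coord z (@inord l j) = mast_coord z j.
Proof. by rewrite /mast_coord inord_val. Qed.

Lemma mast_coordD z w j : mast_coord (z + w) j = mast_coord z j + mast_coord w j.
Proof.
rewrite -!(mast_coord_inord _ j); 
apply: (mast_comb_inj (c' := fun i => mast_coord z i + mast_coord w i)).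
  by rewrite -mast_combD !mast_coordK.
by rewrite leq_ord.
Qed.

Lemma mast_coordZ c z j : mast_coord (kscale pi c z) j = c * mast_coord z j.
Proof.
rewrite -!(mast_coord_inord _ j); 
apply: (mast_comb_inj (c' := fun i => c * mast_coord z i)).
  by rewrite -mast_comb_scale !mast_coordK.
by rewrite leq_ord.
Qed.

Lemma mast_coord0 j : mast_coord 0 j = 0.
Proof. by rewrite -(kscale0 pi 0) mast_coordZ mul0r. Qed.

Lemma mast_coord_sum n (c : nat -> K) (F : nat -> U) j :
  mast_coord (\sum_(0 <= k < n) kscale pi (c k) (F k)) j =
  \sum_(0 <= k < n) c k * mast_coord (F k) j.
Proof.
rewrite (big_morph (fun z => mast_coord z j) (fun z w => mast_coordD z w j)
  (mast_coord0 j)).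
by apply: eq_bigr => k _; rewrite mast_coordZ.
Qed.

Lemma mast_coord_elt a b : (a <= l)%N -> (b <= l)%N ->
  mast_coord (X b) a = (a == b)%:R.
Proof. by move=> la lb; rewrite -{1}(mast_comb_elt lb) mast_combK. Qed.

Lemma mast_coord_low k z j : V k z -> (j < k)%N -> (j <= l)%N -> mast_coord z j = 0.
Proof.
move=> Vz jk lj.
have {}Vz : V j.+1 z by apply: layer_le Vz.
have [//|c [c0 ->]] := mast_comb_ex _ Vz.
by rewrite mast_combK // c0.
Qed.

Lemma submodule_pi (S : U -> Prop) f z : submodule S -> S z -> S (pi f *: z).
Proof. by case=> _ _; apply. Qed.

(** Turns a given uniserial module with mast p into matrices, so that the obstructions apply to the
    vertices of p. *)
Lemma mast_urep : urep I l (pnode p) (pstep p a0)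
  (fun f a b => mast_coord (pi f *: X b) a).
Proof.
split.
- by move=> f g a b; rewrite rmorphD scalerDl mast_coordD.
- by move=> c f a b; rewrite kscaleE mast_coordZ.
- move=> f g a b la lb; rewrite -pi_scaleM -{1}[pi g *: X b]mast_coordK.
  rewrite /mast_comb scaler_sumr.
  rewrite (eq_bigr (fun k => kscale pi (mast_coord (pi g *: X b) k) (pi f *: X k))).
    by rewrite mast_coord_sum; apply: eq_bigr => k _; rewrite mulrC.
  by move=> k _; rewrite kscale_pi.
- by move=> a b la lb; rewrite rmorph1 scale1r mast_coord_elt.
- by move=> f a b /piI.2 ->; rewrite scale0r mast_coord0.
- move=> f a b ab lb; apply: (mast_coord_low (k := b)) => //; last by lia.
  by apply: submodule_pi; [apply: layer_sub layV _|apply: layer_elt layV _ _].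
- move=> f a la.
  have := mast_elt_residue admI piI f (layer_sub layV) (layer_jac layV) la
            (layer_elt layV la).
  move/mast_coord_low => /(_ a (ltnSn a) la) H.
  rewrite -[pi f *: X a](subrK (kscale pi (path_coeff f (pvertex (pnode p a))) (X a))).
  by rewrite mast_coordD H add0r mast_coordZ mast_coord_elt // eqxx mulr1.
- move=> v a b la lb; rewrite vertex_mast_elt //.
  case: (eqVneq a b) => [->|ab].
    by rewrite eq_sym; case: eqP => _; rewrite ?mast_coord_elt ?eqxx ?mast_coord0.
  by case: eqP => _; rewrite ?mast_coord_elt ?(negPf ab) ?mast_coord0.
- by move=> k a lk la; rewrite -mast_eltS // mast_coord_elt.
- by move=> k lk; apply: pstep_src.
- by move=> k lk; apply: pstep_tgt.
Qed.

End Coordinates.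

(** * Detours and slack halyards *)

Lemma meval_horner_var (K : fieldType) n (i : 'I_n) (h : {poly K}) (v : 'I_n -> K) :
  ((map_poly (@mpolyC n K) h).['X_i]).@[v] = h.[v i].
Proof.
elim/poly_ind: h => [|h c IH]; first by rewrite rmorph0 !horner0 meval0.
rewrite rmorphD rmorphM /= map_polyX map_polyC !hornerE mevalD mevalM IH.
by rewrite mevalXU mevalC.
Qed.

Section Detours.
Context (G : quiver) (p : qpath G) (a0 : arrow G).
Implicit Types (a : arrow G) (u v : qpath G).

Lemma right_subpath_ptake u : u \in right_subpaths p ->
  (plen u <= plen p)%N /\ u = ptake (plen u) p.
Proof.
case/mapP => k; rewrite mem_iota add0n ltnS => /andP[_ lk] ->.
by rewrite plen_ptake.
Qed.

Lemma longer_subpathE a u v : v \in longer_subpaths p a u ->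
  [/\ (plen u < plen v)%N, (plen v <= plen p)%N, v = ptake (plen v) p
    & pnode p (plen v) = tgt a].
Proof.
rewrite mem_filter => /andP[/andP[uv /eqP ev] /right_subpath_ptake[lv vE]].
by split=> //; rewrite -ev {2}vE pend_ptake.
Qed.

Lemma detourE a u : detour p a u ->
  [/\ u = ptake (plen u) p, src a = pnode p (plen u), a != pstep p a0 (plen u)
    & exists2 q, (plen u < q <= plen p)%N & tgt a = pnode p q].
Proof.
case/and3P=> /right_subpath_ptake[lu uE] aw lg.
have [v vin] : exists v, v \in longer_subpaths p a u.
  by case: (longer_subpaths p a u) lg => // v s _; exists v; rewrite mem_head.
have [uv lv _ ev] := longer_subpathE vin.
have sa : src a = pnode p (plen u).
  move: aw; rewrite /pcomp; case: eqP => // e _.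
  by rewrite -pend_ptake // -uE -e.
split=> //; last by exists (plen v); rewrite ?uv.
apply: contraTneq aw => ->.
have -> : pcomp (parrow (pstep p a0 (plen u))) u = Some (ptake (plen u).+1 p).
  by rewrite {2}uE pcomp_pstep // (leq_trans uv).
rewrite negbK; apply/mapP; exists (plen u).+1 => //.
by rewrite mem_iota add0n ltnS (leq_trans uv).
Qed.

Lemma didxE (d : detour_index p) : 
  didx_path d \in longer_subpaths p (didx_detour d).1 (didx_detour d).2.
Proof.
have := valP d; case/allpairsPdep => au [v [_ vin E]].
by rewrite /didx_path /didx_detour -/(val d) E.
Qed.

Lemma didx_inj (d d' : detour_index p) : didx_detour d = didx_detour d' ->
  plen (didx_path d) = plen (didx_path d') -> d = d'.
Proof.
move=> e1 e2; apply: val_inj; rewrite [LHS]surjective_pairing [RHS]surjective_pairing.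
congr (_, _); first exact: e1.
have [_ _ h _] := longer_subpathE (didxE d).
have [_ _ h' _] := longer_subpathE (didxE d').
by rewrite -/(didx_path d) -/(didx_path d') h h' e2.
Qed.

End Detours.

(** Inclusion of M(i+1) in N(j+1) passes down to M(i) in N(j). Otherwise N(j) lies in M(i), and
    simplicity of N(j+1)/N(j) puts N(j+1), hence M(i+1), inside M(i). *)
Lemma composition_length_le (L : pzRingType) (U : lmodType L) m n :
  uniserial U -> composition_length U m -> composition_length U n -> (m <= n)%N.
Proof.
move=> [_ chain] [M [Ms M0 Mt Mstep]] [N [Ns N0 Nt Nstep]].
suff gen j i : (j <= n)%N -> (i <= m)%N -> included (M i) (N j) -> (i <= j)%N.
  by apply: (gen n m).
elim: j i => [|j IH] [|i] // lj li MN; have [le nle sim] := Mstep i li.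
  exfalso; apply: nle => z /MN/N0 ->; by case: (Ms i (ltnW li)).
have [leN _ simN] := Nstep j lj.
rewrite ltnS; apply: IH => //; [exact: ltnW|exact: ltnW|].
have sM := Ms i (ltnW li).
case: (chain (M i) (N j) sM (Ns j (ltnW lj))) => // NM.
have MN' : included (M i) (N j.+1) by move=> z /le/MN.
case: (simN (M i) sM NM MN') => // NM'.
by exfalso; apply: nle => z /MN/NM'.
Qed.

(** * Slack halyards and the recurrence of the top vertex *)

Section Halyards.
Context (K : fieldType) (G : quiver) (I : pathalg K G -> Prop) (L : pzRingType).
Context (pi : {rmorphism pathalg K G -> L}).
Context (admI : admissible I) (piI : quotient_map I pi).
Context (p : qpath G) (a0 : arrow G).
Local Notation KG := (pathalg K G).
Local Notation l := (plen p).
Local Notation arr a := (path_elt K (parrow a)).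
Local Notation vert e := (path_elt K (pvertex e)).

Section Layers.
Context (U : lmodType L) (x : U) (V : nat -> U -> Prop) (layV : layers p pi x V).
Local Notation X := (mast_elt p pi x).

Lemma mast_elt_layer z j k : (k <= l)%N -> V j z -> V (j + k)%N (mast_elt p pi z k).
Proof.
move=> lk Vz; elim: k lk => [_|k IH lk].
  by rewrite addn0; apply: submodule_pi => //; apply: (layer_sub layV).
rewrite (mast_eltS a0) // addnS; apply: (layer_jac layV); last by apply: IH; lia.
exact: jacobson_parrow admI piI _.
Qed.

Lemma mast_comb_layer k c :
  (forall j, (j < k)%N -> c j = 0) -> V k (mast_comb pi p x c).
Proof.
move=> c0; apply: submodule_sum => [|j]; first exact: (layer_sub layV).
rewrite mem_index_iota => /andP[_ lj]; have [jk|kj] := ltnP j k.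
  by rewrite c0 // kscale0; case: (layer_sub layV k).
apply: (layer_le layV kj); apply: submodule_kscale; first exact: (layer_sub layV).
exact: (layer_elt layV).
Qed.

Lemma vertex_mast_coord v z m : (m <= l)%N ->
  mast_coord layV (pi (vert v) *: z) m = (v == pnode p m)%:R * mast_coord layV z m.
Proof.
move=> lm; rewrite -{1}(mast_coordK layV z) /mast_comb scaler_sumr.
rewrite (eq_big_nat _ _ (F2 := fun k => kscale pi (mast_coord layV z k)
  (if v == pnode p k then X k else 0))); last first.
  by move=> k /andP[_ lk]; rewrite kscale_pi vertex_mast_elt.
rewrite mast_coord_sum (eq_big_nat _ _ (F2 := fun k =>
  (k == m)%:R * ((v == pnode p k)%:R * mast_coord layV z k))).
  by rewrite sum_nat_delta.
move=> k /andP[_ lk]; case: ifP => _; last by rewrite mast_coord0 !mulr0 mul0r mulr0.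
by rewrite mast_coord_elt // mul1r mulrC eq_sym.
Qed.

Lemma mast_coord_vertex v z m : pi (vert v) *: z = z -> (m <= l)%N ->
  mast_coord layV z m != 0 -> pnode p m = v.
Proof.
move=> vz lm; rewrite -vz vertex_mast_coord //.
by have [-> //|_] := eqVneq v (pnode p m); rewrite mul0r eqxx.
Qed.

Lemma Jpow_layer j z : Jpow j z -> V j z.
Proof.
elim: j z => [|j IH] z /=; first by move=> _; apply: (layer_all layV).
case=> n [r [y [ry ->]]]; have [V0 VD _] := layer_sub layV j.+1.
apply: big_ind => // i _; have [jr Jy] := ry i.
by apply: (layer_jac layV) => //; apply: IH.
Qed.

Lemma Jpow_mast_elt j : (j <= l)%N -> Jpow j (X j).
Proof.
elim: j => [//|j IH] lj; exists 1%N, (fun=> pi (arr (pstep p a0 j))), (fun=> X j).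
split; last by rewrite big_ord1 (mast_eltS a0).
by move=> _; split; [apply: (jacobson_parrow admI piI)|apply: IH; lia].
Qed.

(** Fixed by the vertex v, z has coordinates only in layers at v, so it is a nonzero multiple of
    [X t]. This locates the end of a halyard edge whose target occurs only once on p. *)
Lemma halyard_layer v (z : U) j t : pi (vert v) *: z = z -> z != 0 -> (t <= l)%N ->
  (forall m, (m <= l)%N -> pnode p m = v -> m = t) ->
  (forall y, Jpow j y <-> exists r : L, y = r *: z) -> j = t.
Proof.
move=> vz z0 lt tP JP.
have zE : z = kscale pi (mast_coord layV z t) (X t).
  rewrite -[LHS](mast_coordK layV z) /mast_comb.
  rewrite (bigD1_seq t) ?mem_index_iota ?iota_uniq //= big_nat_cond big1 ?addr0 //.
  move=> m /andP[/andP[_ lm] mt]; suff -> : mast_coord layV z m = 0 by rewrite kscale0.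
  apply/eqP; apply: contraNT mt => /(mast_coord_vertex vz lm) mv.
  by rewrite (tP m lm mv).
have c0 : mast_coord layV z t != 0.
  by apply: contraNneq z0 => c0; rewrite zE c0 kscale0.
have Jt : Jpow j (X t).
  apply/JP; exists (pi ((mast_coord layV z t)^-1 *: (1 : KG))).
  rewrite -kscaleE1 {2}zE kscaleA mulVf //.
  by rewrite kscale1.
have jt : (j <= t)%N.
  rewrite leqNgt; apply/negP => tj; apply: (layer_eltN layV lt).
  exact: (layer_le layV tj) (Jpow_layer Jt).
apply/eqP; rewrite eqn_leq jt /= leqNgt; apply/negP => jt'.
have lj : (j <= l)%N := leq_trans jt lt.
apply: (layer_eltN layV lj); apply: (layer_le layV jt').
have /JP[r ->] := Jpow_mast_elt lj.
rewrite zE; have [_ _ VZ] := layer_sub layV t; apply: VZ.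
apply: submodule_kscale; first exact: (layer_sub layV).
exact: (layer_elt layV).
Qed.

End Layers.

Lemma detour_value_vertex (U : lmodType L) (x : U) a u :
  pi (vert (tgt a)) *: detour_value pi x a u = detour_value pi x a u.
Proof.
apply: etrans (pi_scaleM _ _ _ _) _.
apply: (congr1 (fun f => pi f *: x)); apply: etrans (mulrA _ _ _) _.
apply: (congr1 (fun f => f * path_elt K u)).
by apply: etrans (path_eltM _ _ _) _; rewrite pcomp_vl eqxx.
Qed.

(** The condition in [in_V] with module and top element exposed, so that points coming from
    isomorphic modules can be compared. *)
Definition detour_coords (U : lmodType L) (x : U)
    (k : {ffun detour_index p -> K}) : Prop :=
  [/\ is_mast pi U p, top_element pi x
    & forall a u, detour p a u ->
        detour_value pi x a u =
        \sum_(d : detour_index p | didx_detour d == (a, u))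
           pi (k d *: path_elt K (didx_path d)) *: x].

(** Transported to U, x' becomes w = c_0 x + z, with z spanned by elements [X r], r > 0, at the top
    vertex. If no such r satisfies r + length u < length p, then alpha u and all longer right
    subpaths kill z, and w has the same coordinates as x. *)
Lemma top_recurs (U U' : lmodType L) (x : U) (x' : U') k k' (phi : U' -> U)
    (d : detour_index p) a u :
  detour_coords x k -> detour_coords x' k' ->
  {morph phi : y z / y + z} -> (forall r y, phi (r *: y) = r *: phi y) ->
  injective phi -> detour p a u -> didx_detour d = (a, u) -> k d != k' d ->
  exists r, [/\ (0 < r)%N, (r + plen u < l)%N & pnode p r = pnode p 0].
Proof.
move=> [mU tx xk] [mU' tx' xk'] phiD phiZ phi_inj dau dE kk.
have [uE sa _ [q /andP[uq lq] _]] := detourE a0 dau.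
have l0 : (0 < l)%N by lia.
have [x0 [V layV]] := layers_exist a0 admI piI l0 mU tx.
have [x0' [V' layV']] := layers_exist a0 admI piI l0 mU' tx'.
have phi0 : phi 0 = 0 by rewrite -(scale0r (0 : U')) phiZ scale0r.
apply: NNPP => nr.
pose w := phi x'; pose c := mast_coord layV w.
have w0 : pi (vert (pstart p)) *: w = w by rewrite -phiZ x0'.
have cj j : (0 < j)%N -> (j < l - plen u)%N -> c j = 0.
  move=> j0 jl; apply/eqP/negP => /negP cj; apply: nr; exists j.
  split=> //; first by lia.
  by apply: (mast_coord_vertex w0) cj; lia.
pose z := mast_comb pi p x (fun j => if j == 0%N then 0 else c j).
have Vz : V (l - plen u)%N z.
  by apply: mast_comb_layer => // j jl; case: posnP => // j0; apply: cj.
have X0 : mast_elt p pi x 0 = x by rewrite /mast_elt ptake0.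
have wE : w = kscale pi (c 0%N) x + z.
  rewrite -X0 -(mast_comb_elt pi x (leq0n l)) mast_comb_scale mast_combD.
  rewrite -[LHS](mast_coordK layV); apply: eq_bigr => j _.
  congr (kscale pi _ _); case: (eqVneq j 0%N) => [->|_]; first by rewrite mulr1 addr0.
  by rewrite mulr0 add0r.
have zl n : (plen u < n)%N -> (n <= l)%N -> mast_elt p pi z n = 0.
  move=> un ln; apply: (layer_end layV (k := (l - plen u + n)%N)); first by lia.
  exact: (mast_elt_layer layV).
have wl n : (plen u < n)%N -> (n <= l)%N ->
    mast_elt p pi w n = kscale pi (c 0%N) (mast_elt p pi x n).
  move=> un ln; rewrite -[RHS]addr0 -(zl n un ln) wE.
  by rewrite /mast_elt scalerDr kscale_pi.
(* The mast sends w to c_0 p x, which is the image of the nonzero element p x'. *)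
have c0 : c 0%N != 0.
  apply/eqP => c0; apply: (layer_eltN layV' (leqnn l)).
  have -> : mast_elt p pi x' l = 0.
    apply: phi_inj; rewrite phi0 [LHS]phiZ -/w; apply: etrans (wl l _ (leqnn l)) _.
      by lia.
    by rewrite c0 kscale0.
  by case: (layer_sub layV' l.+1).
have wau : detour_value pi w a u = kscale pi (c 0%N) (detour_value pi x a u).
  rewrite -[RHS]addr0 /detour_value -kscale_pi.
  suff <- : pi (arr a * path_elt K u) *: z = 0 by rewrite -scalerDr -wE.
  rewrite -pi_scaleM uE; apply: (layer_end layV (k := l.+1)) => //.
  apply: (layer_jac layV); first exact: (jacobson_parrow admI piI).
  rewrite -[X in V X _](subnK (m := plen u) (n := l)); last by lia.
  by apply: (mast_elt_layer layV) => //; lia.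
have dv (b : detour_index p) : didx_detour b == (a, u) ->
    (plen u < plen (didx_path b) <= l)%N /\ didx_path b = ptake (plen (didx_path b)) p.
  move=> /eqP bE; have := didxE b; rewrite bE => /longer_subpathE[ub lb eb _].
  by rewrite ub lb.
have E1 : detour_value pi w a u =
    \sum_(b : detour_index p | didx_detour b == (a, u))
      kscale pi (k' b * c 0%N) (mast_elt p pi x (plen (didx_path b))).
  rewrite /detour_value -phiZ -/(detour_value pi x' a u) xk' //.
  rewrite (big_morph phi phiD phi0); apply: eq_bigr => b /dv[/andP[ub lb] bE].
  apply: etrans (phiZ _ _) _; apply: etrans (kscaleE _ _ _ _) _.
  apply: esym; apply: etrans (esym (kscaleA _ _ _ _)) _.
  apply: (congr1 (kscale pi (k' b))); apply: etrans (esym (wl _ ub lb)) _.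
  by rewrite /mast_elt -bE.
have E2 : detour_value pi w a u =
    \sum_(b : detour_index p | didx_detour b == (a, u))
      kscale pi (k b * c 0%N) (mast_elt p pi x (plen (didx_path b))).
  rewrite wau xk //.
  rewrite (big_morph (kscale pi (c 0%N)) (@kscaleDr _ _ _ pi U _) (kscaler0 pi _ _)).
  apply: eq_bigr => b /dv[_ bE].
  apply: etrans (congr1 (kscale pi (c 0%N)) (kscaleE _ _ _ _)) _.
  rewrite kscaleA mulrC; apply: (congr1 (kscale pi (k b * c 0%N))).
  by rewrite /mast_elt -bE.
(* For fixed (a, u) the paths v_i have different lengths, so each coefficient is read off in its own
   layer. *)
have coordE (f : {ffun detour_index p -> K}) : 
    mast_coord layV (\sum_(b : detour_index p | didx_detour b == (a, u))
      kscale pi (f b * c 0%N) (mast_elt p pi x (plen (didx_path b))))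
      (plen (didx_path d)) = f d * c 0%N.
  rewrite (big_morph (fun y => mast_coord layV y _)
    (fun y y' => mast_coordD layV y y' _)
    (mast_coord0 layV _)).
  have [/andP[_ ld] _] := dv d (introT eqP dE).
  transitivity (\sum_(b : detour_index p | didx_detour b == (a, u))
      (b == d)%:R * (f d * c 0%N)).
    apply: eq_bigr => b bau; have [/andP[_ lb] _] := dv b bau.
    apply: etrans (mast_coordZ _ _ _ _) _; rewrite mast_coord_elt //.
    have [->|bd] := eqVneq b d; first by rewrite eqxx mulr1 mul1r.
    case: eqP => [e|_]; last by rewrite mulr0 mul0r.
    by case/eqP: bd; apply: didx_inj; rewrite // dE; apply/eqP.
  rewrite (bigD1 d) ?dE //= eqxx mul1r big1 ?addr0 // => b /andP[_ /negPf ->].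
  exact: mul0r.
move: kk; apply/negP; rewrite negbK; apply/eqP; apply: (mulIf c0).
by rewrite -(coordE k) -(coordE k') -E1 -E2.
Qed.

Lemma slack_top_recurs a u : finite_uniserial_type L -> slack_halyard pi p a u ->
  exists r, [/\ (0 < r)%N, (r + plen u < l)%N & pnode p r = pnode p 0].
Proof.
move=> [n [W WP]] [[dau _] [d dE dT]].
(* One coordinate value per isomorphism class, with 0 for classes that give no point of V_p. *)
have sel (i : 'I_n) : exists c : K,
    (exists k (U : lmodType L) (x : U), detour_coords x k /\ isomorphic U (W i)) ->
    exists k (U : lmodType L) (x : U), [/\ detour_coords x k, isomorphic U (W i) & k d = c].
  have [[k [U [x [h1 h2]]]]|ne] := classic
    (exists k (U : lmodType L) (x : U), detour_coords x k /\ isomorphic U (W i)).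
    by exists (k d) => _; exists k, U, x.
  by exists 0.
have {sel} [c cP] := fin_all_exists sel.
(* By transcendence, some point of V_p avoids all the selected values. *)
pose h : {poly K} := \prod_i ('X - (c i)%:P).
have h0 : h != 0 by apply/prodf_neq0 => i _; rewrite polyXsubC_eq0.
have [k [kV hk]] : exists k, in_V pi k /\ h.[k d] != 0.
  apply: NNPP => ne; apply: (dT h h0) => k kV.
  apply: etrans (meval_horner_var _ _ _) _; rewrite enum_rankK.
  by apply/eqP/negP => /negP hk; apply: ne; exists k.
have [U [x [mU tx xk]]] := kV.
have [i Ui] := WP U (let: And3 h _ _ := mU in h).
have [k' [U' [x' [h' U'i k'd]]]] : exists k (U : lmodType L) (x : U),
    [/\ detour_coords x k, isomorphic U (W i) & k d = c i].
  by apply: cP; exists k, U, x.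
have kk : k d != k' d.
  apply: contraNneq hk => kd; rewrite kd k'd /h horner_prod (bigD1 i) //=.
  by rewrite hornerXsubC subrr mul0r.
have [f [f' fK fK']] := Ui; have [g [g' gK gK']] := U'i.
apply: (@top_recurs U U' x x' k k' (f' \o g) d a u) => //.
- by move=> y z /=; apply: (can_inj fK); rewrite fK' !linearD !fK'.
- by move=> r y /=; apply: (can_inj fK); rewrite fK' !linearZ /= !fK'.
- by apply: inj_comp; [apply: can_inj fK' | apply: can_inj gK].
Qed.

End Halyards.

(** * Comparison with the three displayed graphs *)

Section Naming.
Context (V : finType) (s : seq V).

(** Distinct vertices listed in [s] are named 1, 2, ... in order; [enum V] supplies names for the
    others. *)
Definition node_name (v : V) : nat := (index v (s ++ enum V)).+1.

Lemma node_name_inj : injective node_name.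
Proof.
move=> v w [e]; have vin b : b \in s ++ enum V by rewrite mem_cat mem_enum orbT.
by rewrite -(nth_index v (vin v)) e (nth_index v (vin w)).
Qed.

Lemma arrow_name_inj : injective (fun v : V => enum_rank v : nat).
Proof. by move=> v w /ord_inj/enum_rank_inj. Qed.

End Naming.

Lemma onth_Some (T : Type) (x0 : T) s i a : onth s i = Some a ->
  (i < size s)%N /\ nth x0 s i = a.
Proof. by elim: s i => [|b s IH] [|i] //= => [[->]|/IH]. Qed.

Lemma pnodes_mkseq (G : quiver) (p : qpath G) :
  pnodes p = mkseq (pnode p) (plen p).+1.
Proof.
apply: (@eq_from_nth _ (pstart p)); first by rewrite size_mkseq /= size_map.
by move=> i; rewrite /= size_map => li; rewrite nth_mkseq.
Qed.

Lemma halyard_edge (K : fieldType) (G : quiver) (I : pathalg K G -> Prop)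
    (L : pzRingType) (pi : {rmorphism pathalg K G -> L}) (p : qpath G)
    (H : arrow G -> qpath G -> Prop) (U : lmodType L) (x : U) (a0 : arrow G) :
  admissible I -> quotient_map I pi -> (0 < plen p)%N ->
  is_mast pi U p -> top_element pi x ->
  forall a i j, ledge (halyard_graph pi p H x) a i j ->
  [/\ (i < plen p)%N, a = pstep p a0 i & j = i.+1] \/
  exists u, [/\ H a u, i = plen u & forall t, (t <= plen p)%N ->
    (forall m, (m <= plen p)%N -> pnode p m = tgt a -> m = t) -> j = t].
Proof.
move=> admI piI l0 mU tx a i j [[/(onth_Some a0)[li <-] ->]|]; first by left.
case=> u [Hau -> dv JP]; right; exists u; split=> // t lt tP.
have [_ [V layV]] := layers_exist a0 admI piI l0 mU tx.
apply: (halyard_layer admI piI a0 layV _ dv lt tP JP).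
exact: detour_value_vertex.
Qed.

Theorem theorem7p2 (K : fieldType) (G : quiver) (I : pathalg K G -> Prop)
    (L : pzRingType) (pi : {rmorphism pathalg K G -> L}) (p : qpath G) :
  (forall s : seq K, exists c : K, c \notin s) ->
  admissible I ->
  quotient_map I pi ->
  finite_uniserial_type L ->
  (exists U : lmodType L, is_mast pi U p /\
     exists2 n, composition_length U n & (n <= 5)%N) ->
  forall H : arrow G -> qpath G -> Prop,
  (exists a u, H a u) ->
  (forall a u, H a u -> slack_halyard pi p a u /\ plen u <> 0%N) ->
  forall (U : lmodType L) (x : U), is_mast pi U p -> top_element pi x ->
  [\/ exists w w' w'' alpha,
        subgraph_of (halyard_graph pi p H x) (graph_A w w' w'' alpha),
      exists w w' w'' alpha,
        subgraph_of (halyard_graph pi p H x) (graph_B w w' w'' alpha)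
    | exists alpha beta gamma,
        subgraph_of (halyard_graph pi p H x) (graph_C alpha beta gamma)].
Proof.
move=> infK admI piI finL [U0 [[uU0 cU0 _] [n0 cn0 n5]]] H [a0 [u0 Hau0]] HP U x mU tx.
have l4 : (plen p <= 4)%N by have := composition_length_le uU0 cU0 cn0; lia.
have shape a u : H a u -> (plen u < plen p)%N /\
    mast_shape (plen p) (pnode p) (pstep p a0) a (plen u).
  move=> Hau; have [slack u0'] := HP a u Hau.
  have [_ sa aA [q /andP[uq lq] ta]] := detourE a0 slack.1.1.
  have up : (plen u < plen p)%N by lia.
  split=> //; have l0 : (0 < plen p)%N by lia.
  have [_ [V layV]] := layers_exist a0 admI piI l0 mU tx.
  have R := mast_urep admI piI a0 layV.
  have [r [r0 ru er]] := slack_top_recurs admI piI a0 finL slack.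
  apply: (classification (s := @src G) (t := @tgt G) (r := r) (q := q)) => //.
  - by move=> k lk; apply: pstep_src.
  - by move=> k lk; apply: pstep_tgt.
  - by move=> i j d; apply: (no_bypass infK admI piI finL R).
  - by move=> i; apply: (no_double_loop infK admI piI finL R).
  - by lia.
  - by rewrite uq.
have [lu0 sh0] := shape a0 u0 Hau0.
have l0 : (0 < plen p)%N by lia.
have edge := halyard_edge (H := H) a0 admI piI l0 mU tx.
pose g (a : arrow G) : nat := enum_rank a.
have g_inj : injective g by apply: arrow_name_inj.
(* One halyard fixes the vertex pattern of p. The three patterns exclude each other, so all halyards
   in [H] have the same shape. *)
case: sh0 => [l3 e10 e20 e30 e4 _ _ | lE e10 e20 e30 e40 _ _ |
  lE e10 e20 e31 e40 e41 A20 _ _].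
- have e43 : plen p = 4%N -> pnode p 4 != pnode p 0 /\ pnode p 4 != pnode p 3 by [].
  (* In length 3, [pnode p 4] is the default [pstart p] and merely repeats the first entry. *)
  pose f := node_name [:: pnode p 0; pnode p 3; pnode p 4].
  have f0 : f (pnode p 0) = 1%N by rewrite /f /node_name /= eqxx.
  have f3 : f (pnode p 3) = 2%N.
    by rewrite /f /node_name /= eq_sym (negPf e30) eqxx.
  have lE : plen p = 3%N \/ plen p = 4%N by lia.
  constructor 1; exists (g (pstep p a0 0)), (g (pstep p a0 1)), (g (pstep p a0 3)),
    (g (pstep p a0 2)), f, g; split=> //; first exact: node_name_inj.
    rewrite -[lnodes (halyard_graph _ _ _ _)]/(pnodes p) pnodes_mkseq.
    case: lE => lE; rewrite lE /= e10 e20 f0 f3 //.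
    have [e40 e43'] := e43 lE; rewrite /f /node_name /=.
    rewrite [_ == pnode p 4]eq_sym (negPf e40).
    by rewrite [_ == pnode p 4]eq_sym (negPf e43') eqxx.
  move=> a i j /edge[[li -> ->]|[u [Hau -> tP]]].
    by case: i li => [|[|[|[|i]]]] li; rewrite /= !inE ?eqxx ?orbT //; lia.
  have [_ sh] := shape a u Hau.
  case: sh => [_ _ _ _ _ uE aE | _ _ _ /eqP | _]; last 2 first.
  - by rewrite (negPf e30).
  - by rewrite e10 eqxx.
  (* The target of the halyard occurs on p in layer 3 only. *)
  have -> : j = 3%N.
    apply: tP => // m lm; rewrite aE pstep_tgt //; case: m lm => [|[|[|[|[|m]]]]] lm //.
    - by move/eqP; rewrite eq_sym (negPf e30).
    - by move/eqP; rewrite e10 eq_sym (negPf e30).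
    - by move/eqP; rewrite e20 eq_sym (negPf e30).
    - by have [_ /eqP] := e43 ltac:(lia).
    - by lia.
  by rewrite uE aE /= !inE !eqxx !orbT.
- pose f := node_name [:: pnode p 0; pnode p 4].
  have f0 : f (pnode p 0) = 1%N by rewrite /f /node_name /= eqxx.
  have f4 : f (pnode p 4) = 2%N.
    by rewrite /f /node_name /= eq_sym (negPf e40) eqxx.
  constructor 2; exists (g (pstep p a0 0)), (g (pstep p a0 1)), (g (pstep p a0 2)),
    (g (pstep p a0 3)), f, g; split=> //; first exact: node_name_inj.
    rewrite -[lnodes (halyard_graph _ _ _ _)]/(pnodes p) pnodes_mkseq lE /=.
    by rewrite e10 e20 e30 f0 f4.
  move=> a i j /edge[[li -> ->]|[u [Hau -> tP]]].
    by case: i li => [|[|[|[|i]]]] li; rewrite /= !inE ?eqxx ?orbT //; lia.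
  have [_ sh] := shape a u Hau.
  case: sh => [_ _ _ | _ _ _ _ _ uE aE | _ ]; first by rewrite e30 eqxx.
    have -> : j = 4%N.
      apply: tP; rewrite ?lE // => m lm; rewrite aE pstep_tgt ?lE //.
      case: m lm => [|[|[|[|[|m]]]]] lm //; rewrite ?e10 ?e20 ?e30;
        by move/eqP; rewrite eq_sym (negPf e40).
    by case: uE => ->; rewrite aE /= !inE !eqxx !orbT.
  by rewrite e10 eqxx.
pose f := node_name [:: pnode p 0; pnode p 1; pnode p 4].
have f0 : f (pnode p 0) = 1%N by rewrite /f /node_name /= eqxx.
have f1 : f (pnode p 1) = 2%N.
  by rewrite /f /node_name /= eq_sym (negPf e10) eqxx.
have f4 : f (pnode p 4) = 3%N.
  rewrite /f /node_name /= [_ == pnode p 4]eq_sym (negPf e40).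
  by rewrite [_ == pnode p 4]eq_sym (negPf e41) eqxx.
constructor 3; exists (g (pstep p a0 0)), (g (pstep p a0 1)), (g (pstep p a0 3)),
  f, g; split=> //; first exact: node_name_inj.
  rewrite -[lnodes (halyard_graph _ _ _ _)]/(pnodes p) pnodes_mkseq lE /=.
  by rewrite e20 e31 f0 f1 f4.
move=> a i j /edge[[li -> ->]|[u [Hau -> tP]]].
  by case: i li => [|[|[|[|i]]]] li; rewrite /= !inE ?A20 ?eqxx ?orbT //; lia.
have [_ sh] := shape a u Hau.
case: sh => [_ /eqP | _ /eqP | _ _ _ _ _ _ _ uE aE]; rewrite ?(negPf e10) //.
have -> : j = 4%N.
  apply: tP; rewrite ?lE // => m lm; rewrite aE pstep_tgt ?lE //.
  case: m lm => [|[|[|[|[|m]]]]] lm //; rewrite ?e20 ?e31;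
    by move/eqP; rewrite eq_sym ?(negPf e40) ?(negPf e41).
by rewrite uE aE /= !inE !eqxx !orbT.
Qed.
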